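(* Let $f:\mathbb{R}^n\to\mathbb{R}$ be twice continuously differentiable with $\|\nabla f(x)-\nabla f(z)\|_2\le L_f\|x-z\|_2$ for all $x,z$ and some $L_f>0$, and let $h:\mathbb{R}^n\to\mathbb{R}\cup\{+\infty\}$ be proper, lower semicontinuous and convex. Let $\mathbb{X}^*$ be the set of minimizers of $f+h$. Suppose that for $\lambda\in(0,\frac{1}{L_f})$ the proximal PL inequality holds: there is $\mu>0$ with $$\tfrac12\|\mathcal{H}_\lambda(x)\|_2^2\ge\mu(\mathcal{F}_\lambda(x)-\mathcal{F}_\lambda^* )\qquad\text{for all }x\in\mathbb{R}^n .$$ Let $p\in[0,1)$, $q>1$, $\kappa_p,\kappa_q>0$. Then for every $x_0\in\mathbb{R}^n$ the trajectory $x(t)$ of $$\dot x=-\kappa_p\frac{\mathcal{H}_\lambda(x)}{\|\mathcal{H}_\lambda(x)\|_2^{1-p}}-\kappa_q\|\mathcal{H}_\lambda(x)\|_2^{q-1}\mathcal{H}_\lambda(x),\qquad x(0)=x_0,$$ converges to $\mathbb{X}^*$ in fixed time $T(x_0)$ bounded by $$T(x_0)\le\frac{1}{\mu(1-\lambda L_f)}\left(\frac{1}{\kappa_p(1-p)}+\frac{1}{\kappa_q(q-1)}\right).$$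
   Context: Definitions: $\mathrm{prox}_{\lambda h}(x)=\arg\min_{z\in\mathbb{R}^n}\left(h(z)+\frac{1}{2\lambda}\|z-x\|_2^2\right)$; the Moreau envelope is $M_{\lambda h}(x)=h(\mathrm{prox}_{\lambda h}(x))+\frac{1}{2\lambda}\|\mathrm{prox}_{\lambda h}(x)-x\|_2^2$; $\mathcal{H}_\lambda(x)=\frac1\lambda\left(x-\mathrm{prox}_{\lambda h}(x-\lambda\nabla f(x))\right)$; the forward–backward envelope is $\mathcal{F}_\lambda(x)=f(x)+M_{\lambda h}(x-\lambda\nabla f(x))-\frac\lambda2\|\nabla f(x)\|_2^2$; and $\mathcal{F}_\lambda^*=\min_x\mathcal{F}_\lambda(x)$ ($\mathcal{F}_\lambda$ shares the same minimizers and optimal value with $f+h$). The right-hand side of the ODE is taken to be $0$ where $\mathcal{H}_\lambda(x)=0$; when it is discontinuous ($p=0$), trajectories are Filippov solutions, i.e. absolutely continuous solutions of $\dot x\in\mathcal{F}[X](x)$ a.e. on $[0,\infty)$, where $X$ is the right-hand side and $\mathcal{F}[X](x)=\bigcap_{\delta>0}\bigcap_{\omega(\mathcal{N}_0)=0}\overline{co}\{X(x^{\delta}\setminus\mathcal{N}_0)\}$, with $x^\delta$ the open ball of radius $\delta$ at $x$, $\omega$ Lebesgue measure, and $\overline{co}$ the closed convex hull. ''$x(t)$ converges to $\mathbb{X}^*$ in time $T(x_0)$'' means $x(t)\in\mathbb{X}^*$ for all $t\ge T(x_0)$. *)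

(* Defs.v *)
(* The space R^n is 'rV[R]_n. *)
From HB Require Import structures.
From mathcomp Require Import all_boot all_order all_algebra.
From mathcomp Require Import all_classical all_reals all_analysis.

Set Implicit Arguments.
Unset Strict Implicit.
Unset Printing Implicit Defensive.

Import Order.TTheory GRing.Theory Num.Theory.
Import numFieldNormedType.Exports.

Local Open Scope classical_set_scope.
Local Open Scope ring_scope.

(* The library norm `|x| on 'rV[R]_n is the sup norm; it induces the same
   topology, but the Euclidean norm has to be introduced separately. *)
Definition l2norm (R : realType) (n : nat) (x : 'rV[R]_n) : R :=
  Num.sqrt (\sum_(i < n) x ord0 i ^+ 2).

Definition partial (R : realType) (n : nat) (f : 'rV[R]_n -> R) (i : 'I_n)
    (x : 'rV[R]_n) : R :=
  'D_(delta_mx ord0 i) f x.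

Definition grad (R : realType) (n : nat) (f : 'rV[R]_n -> R) (x : 'rV[R]_n) :
    'rV[R]_n :=
  \row_(i < n) partial f i x.

Definition twice_continuously_differentiable (R : realType) (n : nat)
    (f : 'rV[R]_n -> R) : Prop :=
  [/\ forall x, differentiable f x,
      forall i x, differentiable (partial f i) x &
      forall i j, continuous (partial (partial f i) j)].

Definition proper_fun (R : realType) (n : nat) (h : 'rV[R]_n -> \bar R) : Prop :=
  (forall x, h x != -oo%E) /\ exists x, h x != +oo%E.

(* At t = 0 and t = 1 the convention 0 * +oo = 0 makes the inequality trivial;
   the right-hand side is never of the form +oo - oo when h is proper. *)
Definition econvex (R : realType) (n : nat) (h : 'rV[R]_n -> \bar R) : Prop :=
  forall (x y : 'rV[R]_n) (t : R), 0 <= t <= 1 ->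
    (h (t *: x + (1 - t) *: y)%R <= t%:E * h x + (1 - t)%:E * h y)%E.

Definition argmin (R : realType) (n : nat) (F : 'rV[R]_n -> \bar R) :
    set 'rV[R]_n :=
  [set x | forall y, (F x <= F y)%E].

(* m = min F, which includes that the minimum is attained. *)
Definition is_min (R : realType) (n : nat) (F : 'rV[R]_n -> \bar R)
    (m : \bar R) : Prop :=
  exists2 x, argmin F x & F x = m.

(* The argmin is a singleton when h is proper, lower semicontinuous and convex
   and 0 < lambda; xget picks its element. *)
Definition prox (R : realType) (n : nat) (lambda : R) (h : 'rV[R]_n -> \bar R)
    (x : 'rV[R]_n) : 'rV[R]_n :=
  xget 0 (argmin (fun z =>
    (h z + ((2 * lambda)^-1 * l2norm (z - x) ^+ 2)%:E)%E)).

Definition moreau (R : realType) (n : nat) (lambda : R)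
    (h : 'rV[R]_n -> \bar R) (x : 'rV[R]_n) : \bar R :=
  (h (prox lambda h x)
    + ((2 * lambda)^-1 * l2norm (prox lambda h x - x) ^+ 2)%:E)%E.

Definition residual (R : realType) (n : nat) (f : 'rV[R]_n -> R)
    (h : 'rV[R]_n -> \bar R) (lambda : R) (x : 'rV[R]_n) : 'rV[R]_n :=
  lambda^-1 *: (x - prox lambda h (x - lambda *: grad f x)).

Definition fb_envelope (R : realType) (n : nat) (f : 'rV[R]_n -> R)
    (h : 'rV[R]_n -> \bar R) (lambda : R) (x : 'rV[R]_n) : \bar R :=
  ((f x)%:E + moreau lambda h (x - lambda *: grad f x)%R
    - (lambda / 2 * l2norm (grad f x) ^+ 2)%:E)%E.

Definition proximal_PL (R : realType) (n : nat) (f : 'rV[R]_n -> R)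
    (h : 'rV[R]_n -> \bar R) (lambda mu : R) (Fstar : \bar R) : Prop :=
  forall x : 'rV[R]_n,
    (mu%:E * (fb_envelope f h lambda x - Fstar)
      <= (2^-1 * l2norm (residual f h lambda x) ^+ 2)%:E)%E.

Definition minimizers (R : realType) (n : nat) (f : 'rV[R]_n -> R)
    (h : 'rV[R]_n -> \bar R) : set 'rV[R]_n :=
  argmin (fun x => ((f x)%:E + h x)%E).

Definition fxt_field (R : realType) (n : nat) (f : 'rV[R]_n -> R)
    (h : 'rV[R]_n -> \bar R) (lambda p q kp kq : R) (x : 'rV[R]_n) :
    'rV[R]_n :=
  let H := residual f h lambda x in
  if H == 0 then 0 else
    - ((kp / l2norm H `^ (1 - p)) *: H) - (kq * l2norm H `^ (q - 1)) *: H.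

(* Lebesgue null sets of R^n: for every e > 0 there is a countable cover by
   closed boxes of total volume at most e. *)
Definition lebesgue_null (R : realType) (n : nat) (N : set 'rV[R]_n) : Prop :=
  forall e : R, 0 < e ->
    exists (D : set nat) (a b : nat -> 'rV[R]_n),
      [/\ forall k i, a k ord0 i <= b k ord0 i,
          N `<=` \bigcup_(k in D)
            [set x | forall i, a k ord0 i <= x ord0 i <= b k ord0 i] &
          (\esum_(k in D) (\prod_(i < n) (b k ord0 i - a k ord0 i))%:E
             <= e%:E)%E].

Definition closed_convex_hull (R : realType) (n : nat) (A : set 'rV[R]_n) :
    set 'rV[R]_n :=
  \bigcap_(C in [set C : set 'rV[R]_n |
                  [/\ closed C, convex_set C & A `<=` C]]) C.

Definition filippov_map (R : realType) (n : nat) (X : 'rV[R]_n -> 'rV[R]_n)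
    (x : 'rV[R]_n) : set 'rV[R]_n :=
  \bigcap_(d in [set d : R | 0 < d])
    \bigcap_(N in [set N | lebesgue_null N])
      closed_convex_hull (X @` ([set y | l2norm (y - x) < d] `\` N)).

Definition absolutely_continuous (R : realType) (n : nat) (a b : R)
    (x : R -> 'rV[R]_n) : Prop :=
  forall e : R, 0 < e -> exists2 d : R, 0 < d &
    forall (m : nat) (s t : 'I_m -> R),
      (forall i, [/\ a <= s i, s i <= t i & t i <= b]) ->
      (forall i j, i != j -> t i <= s j \/ t j <= s i) ->
      \sum_(i < m) (t i - s i) < d ->
      \sum_(i < m) l2norm (x (t i) - x (s i)) < e.

(* Absolute continuity on the unbounded interval [0, +oo[ is meant, as usual
   for differential inclusions, on every compact subinterval. *)
Definition filippov_solution (R : realType) (n : nat)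
    (X : 'rV[R]_n -> 'rV[R]_n) (x0 : 'rV[R]_n) (x : R -> 'rV[R]_n) : Prop :=
  [/\ x 0 = x0,
      forall b : R, 0 <= b -> absolutely_continuous 0 b x &
      {ae @lebesgue_measure R, forall t : R, 0 <= t ->
         derivable x t 1 /\ filippov_map X (x t) (derive1 x t)}].

(* Only continuity is asked at t = 0: for continuous X the one-sided equation
   at 0 follows from the equation on ]0, +oo[. *)
Definition classical_solution (R : realType) (n : nat)
    (X : 'rV[R]_n -> 'rV[R]_n) (x0 : 'rV[R]_n) (x : R -> 'rV[R]_n) : Prop :=
  [/\ x 0 = x0,
      {within `[0, +oo[, continuous x} &
      forall t : R, 0 < t -> is_derive t 1 x (X (x t))].

(* Only for p = 0 can the field fail to be continuous. *)
Definition trajectory (R : realType) (n : nat) (f : 'rV[R]_n -> R)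
    (h : 'rV[R]_n -> \bar R) (lambda p q kp kq : R) (x0 : 'rV[R]_n)
    (x : R -> 'rV[R]_n) : Prop :=
  let X := fxt_field f h lambda p q kp kq in
  if p == 0 then filippov_solution X x0 x else classical_solution X x0 x.

Definition converges_in_time (R : realType) (n : nat) (x : R -> 'rV[R]_n)
    (S : set 'rV[R]_n) (T : R) : Prop :=
  forall t : R, T <= t -> S (x t).

(* Main.v *)
Require Import Defs.
From HB Require Import structures.
From mathcomp Require Import all_boot all_order all_algebra.
From mathcomp Require Import all_classical all_reals all_analysis.
From mathcomp Require finmap.
From mathcomp Require Import ring lra.

Set Implicit Arguments.
Unset Strict Implicit.
Unset Printing Implicit Defensive.

Import Order.TTheory GRing.Theory Num.Theory.
Import numFieldNormedType.Exports.

Local Open Scope classical_set_scope.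
Local Open Scope ring_scope.

(** The forward-backward envelope [F] is a Lyapunov function. Write [P x] for the
    forward-backward step, [H x = (x - P x) / lambda] for the residual, and [m]
    for the minimum of [F]; [L] is the Lipschitz constant of the gradient.

    [F x] is the minimum over [z] of the model
      [f x + <grad f x, z - x> + |z - x|^2 / (2 lambda) + h z],
    attained at [z = P x]. Using the minimizer for [x] in the model for [y], and
    conversely, gives the first-order expansion
      [F y - F x = <H x, y - x> - lambda <grad f y - grad f x, H x> + O(|y - x|^2)]
    ([fbe_expansion]). Hence, along a differentiable curve, the difference
    quotients of [F] are at most [<H, x'> + lambda L |x'| |H|] in the limit
    ([fbe_slope]). The field is [- c H] for some [c >= 0] with
    [c |H|^2 = kp |H|^(1 + p) + kq |H|^(1 + q)], and for [x' = - c H] this bound is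
    [- (1 - lambda L) c |H|^2]. The proximal PL inequality bounds
    [W = 2 mu (F - m)] by [|H|^2], so that, with [c0 = mu (1 - lambda L)],
      [W' <= - 2 c0 (kp W^((1 + p) / 2) + kq W^((1 + q) / 2))].
    The second term makes [W^((1 - q) / 2)] grow at least at rate [c0 kq (q - 1)],
    which brings [W] below [1] before time [1 / (c0 kq (q - 1))] whatever [W 0] is;
    from there the first term makes [W^((1 - p) / 2)] decrease at least at rate
    [c0 kp (1 - p)] and reach zero within [1 / (c0 kp (1 - p))]
    ([fixed_time_extinction]). The sum of the two times is the claimed bound.
    Since [F <= f + h], with [F (P x)] below [F x] unless [P x = x], a minimizer
    of [F] is a minimizer of [f + h] ([argmin_fbe_minimizers]).

    A Filippov solution satisfies the equation almost everywhere only, at the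
    times where [H <> 0], because the field is continuous there and its Filippov
    regularization is a single point; where [H = 0] the slope bound is [0]
    whatever the velocity. The differential inequality is therefore integrated
    for absolutely continuous functions ([abs_cont_nonincreasing]), by a covering
    argument in the place of Lebesgue's differentiation theory. For [p > 0] a
    classical solution is locally Lipschitz, so that the same argument applies. *)

(** * Euclidean norm and inner product *)

Section Euclidean.
Context {R : realType} {n : nat}.
Implicit Types (u v w x y z : 'rV[R]_n) (a : R).

Definition dot u v : R := \sum_(i < n) u ord0 i * v ord0 i.

Lemma dotC u v : dot u v = dot v u.
Proof. by apply: eq_bigr => i _; rewrite mulrC. Qed.

Lemma dotDl u v w : dot (u + v) w = dot u w + dot v w.
Proof. by rewrite -big_split; apply: eq_bigr => i _; rewrite mxE mulrDl. Qed.

Lemma dotZl a u v : dot (a *: u) v = a * dot u v.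
Proof. by rewrite /dot big_distrr; apply: eq_bigr => i _; rewrite mxE -mulrA. Qed.

Lemma dotDr u v w : dot u (v + w) = dot u v + dot u w.
Proof. by rewrite dotC dotDl !(dotC u). Qed.

Lemma dotZr a u v : dot u (a *: v) = a * dot u v.
Proof. by rewrite dotC dotZl dotC. Qed.

Lemma dotNl u v : dot (- u) v = - dot u v.
Proof. by rewrite -scaleN1r dotZl mulN1r. Qed.

Lemma dotNr u v : dot u (- v) = - dot u v.
Proof. by rewrite dotC dotNl dotC. Qed.

Lemma dot0l v : dot 0 v = 0.
Proof. by rewrite -(scale0r v) dotZl mul0r. Qed.

Definition dotE := (dotDl, dotDr, dotNl, dotNr, dotZl, dotZr).

Lemma dot_ge0 u : 0 <= dot u u.
Proof. by apply: sumr_ge0 => i _; rewrite -expr2 sqr_ge0. Qed.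

Lemma l2norm_ge0 u : 0 <= l2norm u.
Proof. exact: sqrtr_ge0. Qed.

Lemma l2norm_sqr u : l2norm u ^+ 2 = dot u u.
Proof.
rewrite sqr_sqrtr; last by apply: sumr_ge0 => i _; rewrite sqr_ge0.
by apply: eq_bigr => i _; rewrite expr2.
Qed.

Lemma l2norm_le u a : 0 <= a -> dot u u <= a ^+ 2 -> l2norm u <= a.
Proof.
by move=> a0; rewrite -l2norm_sqr ler_pXn2r ?nnegrE ?l2norm_ge0.
Qed.

Lemma l2norm_eq0 u : l2norm u = 0 -> u = 0.
Proof.
move=> u0; have := l2norm_sqr u; rewrite u0 expr0n /= => /esym/eqP.
rewrite psumr_eq0 => [/allP h|i _]; last by rewrite -expr2 sqr_ge0.
apply/rowP => i; rewrite mxE; apply/eqP.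
by have := h i (mem_index_enum i); rewrite /= mulf_eq0 orbb.
Qed.

Lemma l2norm_gt0 u : u != 0 -> 0 < l2norm u.
Proof.
move=> u0; rewrite lt_neqAle l2norm_ge0 andbT eq_sym.
by apply: contra_neq u0 => /l2norm_eq0.
Qed.

Lemma l2norm0 : l2norm (0 : 'rV[R]_n) = 0.
Proof.
by apply/eqP; rewrite eq_le l2norm_ge0 andbT l2norm_le // dot0l expr0n.
Qed.

Lemma l2normN u : l2norm (- u) = l2norm u.
Proof. by congr Num.sqrt; apply: eq_bigr => i _; rewrite mxE sqrrN. Qed.

Lemma l2normB u v : l2norm (u - v) = l2norm (v - u).
Proof. by rewrite -l2normN opprB. Qed.

Lemma l2normZ a u : l2norm (a *: u) = `|a| * l2norm u.
Proof.
rewrite -[LHS]ger0_norm ?l2norm_ge0 // -[l2norm u]ger0_norm ?l2norm_ge0 //.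
rewrite -normrM; apply/eqP.
rewrite -(@eqrXn2 _ 2%N) ?normr_ge0 // ?normrM ?exprMn.
by rewrite !real_normK ?num_real // !l2norm_sqr !dotE expr2 mulrA.
Qed.

(** Nonnegativity of the square of [|v|^2 u - <u, v> v]. *)
Lemma dot_le u v : dot u v <= l2norm u * l2norm v.
Proof.
have := l2norm_ge0 u; have := l2norm_ge0 v.
have [->|v0] := eqVneq v 0; first by rewrite dotC dot0l l2norm0 mulr0.
have vv : 0 < dot v v by rewrite -l2norm_sqr exprn_gt0 // l2norm_gt0.
have := dot_ge0 (dot v v *: u - dot u v *: v).
rewrite !dotE (dotC v u); set A := (X in 0 <= X -> _).
have -> : A = dot v v * (dot v v * dot u u - dot u v ^+ 2) by rewrite /A; ring.
rewrite pmulr_rge0 // subr_ge0 -!l2norm_sqr -exprMn => h nv nu.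
apply: le_trans (ler_norm _) _.
rewrite -[leRHS]ger0_norm ?mulr_ge0 //.
by rewrite -ler_sqr ?nnegrE ?normr_ge0 // !real_normK ?num_real // mulrC.
Qed.

Lemma ler_dot_norm u v : `|dot u v| <= l2norm u * l2norm v.
Proof. by rewrite ler_norml dot_le andbT lerNl -dotNl -(l2normN u) dot_le. Qed.

Lemma l2normD u v : l2norm (u + v) <= l2norm u + l2norm v.
Proof.
rewrite l2norm_le ?addr_ge0 ?l2norm_ge0 // !dotE (dotC v u) sqrrD !l2norm_sqr.
by have := dot_le u v; lra.
Qed.

Lemma l2norm_sub u v : l2norm (u - v) <= l2norm u + l2norm v.
Proof. by rewrite -(l2normN v) l2normD. Qed.

Lemma l2norm_dist u v : l2norm u - l2norm v <= l2norm (u - v).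
Proof. by rewrite lerBlDr -{1}(subrK v u) l2normD. Qed.

Lemma mx_le_l2norm u : `|u| <= l2norm u.
Proof.
rewrite [leLHS]/Num.Def.normr /= mx_normrE (bigmax_le _ (l2norm_ge0 u)) // => -[i j] _ /=.
rewrite -[leRHS]ger0_norm ?l2norm_ge0 // -ler_sqr ?nnegrE ?normr_ge0 //.
rewrite !real_normK ?num_real // l2norm_sqr /dot (bigD1 j) //= -expr2 ord1.
by rewrite lerDl sumr_ge0 // => k _; rewrite -expr2 sqr_ge0.
Qed.

Lemma coord_le_mx u i : `|u ord0 i| <= `|u|.
Proof.
rewrite [leRHS]/Num.Def.normr /= mx_normrE.
exact: (le_bigmax _ (fun ij : 'I_1 * 'I_n => `|u ij.1 ij.2|) (ord0, i)).
Qed.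

Lemma l2norm_le_mx u : l2norm u <= n%:R * `|u|.
Proof.
rewrite l2norm_le ?mulr_ge0 //.
apply: (@le_trans _ _ (\sum_(i < n) `|u| ^+ 2)).
  apply: ler_sum => i _; rewrite -expr2 -real_normK ?num_real //.
  by rewrite ler_sqr ?nnegrE ?normr_ge0 // coord_le_mx.
rewrite sumr_const card_ord -[leLHS]mulr_natl exprMn; apply: ler_wpM2r; first exact: sqr_ge0.
by rewrite -natrX ler_nat; case: (n) => // k; rewrite leq_pmulr.
Qed.

Lemma near_l2norm x (e : R) : 0 < e -> nbhs x [set y | l2norm (y - x) < e].
Proof.
move=> e0; apply/nbhs_ballP.
exists (e / n.+1%:R) => /=; first by rewrite divr_gt0 ?ltr0n.
move=> y; rewrite -ball_normE /= distrC => yx.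
apply: le_lt_trans (l2norm_le_mx _) _.
apply: (@le_lt_trans _ _ (n.+1%:R * `|y - x|)).
  by rewrite ler_wpM2r // ler_nat.
by rewrite mulrC -ltr_pdivlMr ?ltr0n.
Qed.

Lemma continuous_l2norm : continuous (@l2norm R n).
Proof.
move=> x; apply/(@cvgrPdist_le _ _ _ _ (nbhs_filter x)) => e e0.
apply: filterS (near_l2norm x e0) => y /= yx.
rewrite ler_norml; apply/andP; split.
  by rewrite lerNl opprB (le_trans (l2norm_dist _ _)) // ltW.
by rewrite (le_trans (l2norm_dist _ _)) // l2normB ltW.
Qed.

Lemma l2norm_nbhs x (A : set 'rV[R]_n) :
  nbhs x A -> exists2 d : R, 0 < d & forall y, l2norm (y - x) < d -> A y.
Proof.
move=> /nbhs_ballP [d d0 dA]; exists d => // y yx; apply: dA.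
rewrite -ball_normE /=; apply: le_lt_trans yx.
by rewrite distrC mx_le_l2norm.
Qed.

Lemma closed_l2ball x (r : R) : closed [set y | l2norm (y - x) <= r].
Proof.
apply: (@preimage_closed _ _ (fun y => l2norm (y - x)) [set` `]-oo, r]]).
- move=> y _; apply: continuous_comp; last exact: continuous_l2norm.
  exact: cvgB cvg_id (cvg_cst _).
- exact: lray_closed.
Qed.

End Euclidean.

(** * The proximal map *)

Section ExtendedValues.
Import finmap.
Context {R : realType}.

Lemma ereal_finite (a : \bar R) : a != -oo%E -> a != +oo%E -> exists r, a = r%:E.
Proof. by case: a => // r _ _; exists r. Qed.

Lemma ge0_eq (a b : R) : a = b -> 0 <= a -> 0 <= b.
Proof. by move=> ->. Qed.

(** Otherwise the sets on which [phi] exceeds one of its values on [K] would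
    cover [K]; a smallest one among the finitely many values that suffice would
    have to exceed another one. *)
Lemma lsc_compact_min (T : ptopologicalType) (K : set T) (phi : T -> \bar R) :
    (forall x, phi x != -oo%E) -> lower_semicontinuous phi ->
    compact K -> K !=set0 ->
  exists2 x, K x & forall y, K y -> (phi x <= phi y)%E.
Proof.
move=> phiN lsc cK [x0 Kx0]; apply: contrapT => nomin.
have below x : K x -> exists2 y, K y & (phi y < phi x)%E.
  move=> Kx; apply: contrapT => noy; apply: nomin; exists x => // y Ky.
  by rewrite leNgt; apply/negP => yx; apply: noy; exists y.
have opn y : open [set x | (phi y < phi x)%E].
  have [/eqP->|yf] := boolP (phi y == +oo%E).
    rewrite (_ : [set x | _] = set0); first exact: open0.
    by apply/seteqP; split => // x /=; rewrite ltNge leey.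
  have [r ->] := ereal_finite (phiN y) yf.
  exact: (iffLR (lower_semicontinuousP phi) lsc r).
move: cK; rewrite compact_cover => /(_ T K (fun y => [set x | (phi y < phi x)%E])).
case=> [y _|x Kx|D DK Kcov]; first exact: opn.
  by have [y Ky yx] := below _ Kx; exists y.
have [d0 d0D _] := Kcov _ Kx0.
have [d _ dmin] := @arg_minP _ _ D [` d0D]%fset predT (fun i => phi (val i)) isT.
have Kd : K (val d) by have := DK _ (valP d); rewrite in_setE.
have [e eD ed] := Kcov _ Kd.
by have := dmin [` eD]%fset isT; rewrite leNgt ed.
Qed.

Lemma lsc_addr_continuous (T : topologicalType) (phi : T -> \bar R) (r : T -> R) :
  (forall x, phi x != -oo%E) -> lower_semicontinuous phi -> continuous r ->
  lower_semicontinuous (fun x => phi x + (r x)%:E)%E.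
Proof.
move=> phiN lsc cr x a ax.
have [eta eta0 aeta] : exists2 eta : R, 0 < eta & ((a - r x + eta)%:E < phi x)%E.
  move: ax (phiN x); case: (phi x) => [s| |] //; last by exists 1; rewrite ?ltry.
  rewrite -EFinD lte_fin => ax _; exists ((s + r x - a) / 2); first by lra.
  by rewrite lte_fin; lra.
have [V xV Va] := lsc _ _ aeta.
exists (V `&` [set y | r x - eta < r y]).
  apply: filterI => //; move: (cr x) => /cvgr_gt; apply.
  by rewrite ltrBlDr ltrDl.
move=> y [/Va Vy /= ry]; case: (phi y) (phiN y) Vy => [s| |] // _; last first.
  by move=> _; rewrite addye // ltry.
by move: ry; rewrite -EFinD !lte_fin; lra.
Qed.

End ExtendedValues.

Section Prox.
Context {R : realType} {n : nat}.
Variables (h : 'rV[R]_n -> \bar R) (lambda : R).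
Hypotheses (h_proper : proper_fun h) (h_lsc : lower_semicontinuous h)
  (h_convex : econvex h) (lambda_gt0 : 0 < lambda).
Implicit Types x y z : 'rV[R]_n.

Lemma compact_l2ball x (r : R) : compact [set y | l2norm (y - x) <= r].
Proof.
apply: bounded_closed_compact; last exact: closed_l2ball.
exists (r + l2norm x); split; first exact: num_real.
move=> M rM y /= yx; apply: (le_trans (mx_le_l2norm _)).
by have := l2norm_dist y x; lra.
Qed.

(** Convexity propagates a lower bound on a unit ball to a linear lower bound
    outside of it, so that the quadratic term of the proximal map wins. *)
Lemma convex_linear_minorant : exists x1 v A,
  [/\ h x1 = v%:E, 0 <= A &
      forall z, 1 <= l2norm (z - x1) -> ((v - A * l2norm (z - x1))%:E <= h z)%E].
Proof.
have [hN [x1 hx1]] := h_proper.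
have [v hv] := ereal_finite (hN x1) hx1.
have [|w _ wmin] := lsc_compact_min hN h_lsc (@compact_l2ball x1 1).
  by exists x1 => /=; rewrite subrr l2norm0.
have wv : (h w <= v%:E)%E by rewrite -hv wmin //= subrr l2norm0.
have [m hm] : exists m, h w = m%:E.
  by apply: ereal_finite => //; rewrite -ltey (le_lt_trans wv) ?ltry.
move: wv; rewrite hm lee_fin => mv.
exists x1, v, (v - m); split => //; first by rewrite subr_ge0.
move=> z; set r := l2norm (z - x1) => r1.
have r0 : 0 < r by lra.
have t01 : 0 <= r^-1 <= 1 by rewrite invr_ge0 ltW //= invf_le1.
have := h_convex z x1 t01; set y := _ + _.
have yx1 : l2norm (y - x1) <= 1.
  have -> : y - x1 = r^-1 *: (z - x1).
    by rewrite /y scalerBl scale1r addrC scalerBr; apply/rowP => i; rewrite !mxE; ring.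
  by rewrite l2normZ ger0_norm ?invr_ge0 ?(ltW r0) // -/r mulVf ?gt_eqF.
have := wmin y yx1; rewrite hm hv => my /(le_trans my).
have := hN z; case: (h z) => [s| |] // _; last by rewrite leey.
rewrite -!EFinM -EFinD !lee_fin => mle.
have : r * m <= r * (r^-1 * s + (1 - r^-1) * v) by rewrite ler_wpM2l // ltW.
rewrite mulrDr !mulrA mulrBr mulr1 divff ?gt_eqF //; lra.
Qed.

(** The value [prox] takes is meaningful only if a minimizer exists: the
    objective is lower semicontinuous, and outside a ball the quadratic term
    beats the linear minorant of [h]. *)
Lemma prox_argmin x : argmin (fun z =>
  (h z + ((2 * lambda)^-1 * l2norm (z - x) ^+ 2)%:E)%E) (prox lambda h x).
Proof.
apply: xgetPex.
have [hN _] := h_proper.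
have [x1 [v [A [hv A0 minor]]]] := convex_linear_minorant.
pose c : R := (2 * lambda)^-1.
have c0 : 0 < c by rewrite invr_gt0 mulr_gt0.
pose D := l2norm (x1 - x).
have D0 : 0 <= D := l2norm_ge0 _.
(* radius beyond which the objective exceeds its value at x1 *)
pose r := Num.max 1 (2 * D + A / c).
have [r1 rA] : 1 <= r /\ 2 * D + A / c <= r by rewrite !le_max !lexx orbT.
have phiN z : (h z + (c * l2norm (z - x) ^+ 2)%:E)%E != -oo%E.
  by have := hN z; case: (h z).
have philsc : lower_semicontinuous (fun z => h z + (c * l2norm (z - x) ^+ 2)%:E)%E.
  apply: lsc_addr_continuous => // z.
  apply: (continuous_comp (f := fun z => l2norm (z - x)) (g := fun t => c * t ^+ 2)).
    apply: continuous_comp; last exact: continuous_l2norm.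
    exact: cvgB cvg_id (cvg_cst _).
  by apply: cvgM; [exact: cvg_cst | exact: exprn_continuous].
have [|p _ pmin] := lsc_compact_min phiN philsc (@compact_l2ball x1 r).
  by exists x1 => /=; rewrite subrr l2norm0; lra.
exists p => z.
have [|rz] := leP (l2norm (z - x1)) r; first exact: pmin.
apply: (@le_trans _ _ (h x1 + (c * l2norm (x1 - x) ^+ 2)%:E)%E).
  by apply: pmin; rewrite /= subrr l2norm0; lra.
have hz : ((v - A * l2norm (z - x1))%:E <= h z)%E by apply: minor; lra.
apply: (@le_trans _ _ ((v - A * l2norm (z - x1))%:E + (c * l2norm (z - x) ^+ 2)%:E)%E);
  last by rewrite leeD2r.
rewrite hv -!EFinD lee_fin -/D.
have zD : l2norm (z - x1) - D <= l2norm (z - x).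
  by have := l2norm_dist (z - x1) (x - x1); rewrite (l2normB x) -/D opprB addrA subrK.
set s := l2norm (z - x1) in rz zD *; set q := l2norm (z - x) in zD *.
have Ac : A = c * (A / c) by rewrite mulrC divfK // gt_eqF.
have Ac0 : 0 <= A / c by rewrite divr_ge0 // ltW.
have : (s - D) ^+ 2 <= q ^+ 2 by rewrite ler_pXn2r ?nnegrE //; lra.
move: (A / c) Ac Ac0 rA => B -> B0 rA sq.
have : 0 <= c * ((q ^+ 2 - (s - D) ^+ 2) + s * (s - 2 * D - B)).
  rewrite mulr_ge0 ?(ltW c0) // addr_ge0 ?subr_ge0 //.
  by rewrite mulr_ge0 ?l2norm_ge0 //; lra.
by move=> H; rewrite -subr_ge0; apply: ge0_eq H; ring.
Qed.

Lemma prox_fin x : exists a, h (prox lambda h x) = a%:E.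
Proof.
have [hN [x1 hx1]] := h_proper.
apply: ereal_finite => //; apply: contraNneq hx1 => hp.
have := prox_argmin x x1; rewrite hp.
by have := hN x1; case: (h x1).
Qed.

(** The first-order optimality condition of the proximal problem: compare the
    minimizer [p] with the points of the segment from [p] to [z], and let them
    tend to [p]. *)
Lemma prox_variational x z a s :
  h (prox lambda h x) = a%:E -> h z = s%:E ->
  a <= s + lambda^-1 * dot (prox lambda h x - x) (z - prox lambda h x).
Proof.
move=> ha hs; have := prox_argmin x; rewrite /argmin /= ha.
set p := prox lambda h x => pmin.
set c : R := (2 * lambda)^-1 in pmin *.
have c0 : 0 < c by rewrite invr_gt0 mulr_gt0.
have -> : lambda^-1 = 2 * c by rewrite /c invfM mulrA divff ?mul1r // pnatr_eq0.
set B := dot (p - x) (z - p).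
have segm t : 0 < t -> t <= 1 -> a <= s + 2 * c * B + t * (c * dot (z - p) (z - p)).
  move=> t0 t1.
  have t01 : 0 <= t <= 1 by rewrite ltW.
  have := h_convex z p t01; set y := _ + _; rewrite ha hs -!EFinM -EFinD => hy.
  have := pmin y => /le_trans /(_ (leeD2r _ hy)).
  rewrite -!EFinD lee_fin.
  have -> : y - x = (p - x) + t *: (z - p).
    by apply/rowP => i; rewrite /y !mxE; ring.
  rewrite !l2norm_sqr /B; move: (p - x) (z - p) => u w.
  rewrite !(dotDl u) !dotE (dotC w u) => H.
  rewrite -(ler_pM2l t0) -subr_ge0; move: H; rewrite -subr_ge0.
  apply: ge0_eq; ring.
apply/ler_addgt0Pr => e e0.
set E := c * dot (z - p) (z - p) in segm.
have E0 : 0 <= E by rewrite mulr_ge0 ?dot_ge0 // ltW.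
have eE : 0 < e + E by lra.
apply: le_trans (segm (e / (e + E)) _ _) _.
- exact: divr_gt0.
- by rewrite ler_pdivrMr // mul1r; lra.
- rewrite lerD2l mulrAC ler_pdivrMr //; nra.
Qed.

(** Add the variational inequalities at the two points and apply
    Cauchy-Schwarz. *)
Lemma prox_nonexpansive x y :
  l2norm (prox lambda h y - prox lambda h x) <= l2norm (y - x).
Proof.
have [a ha] := prox_fin x; have [b hb] := prox_fin y.
have add (A B : R) : a <= b + A -> b <= a + B -> 0 <= A + B by lra.
have {add} := add _ _ (prox_variational ha hb) (prox_variational hb ha).
move: (prox lambda h x) (prox lambda h y) => p p'.
rewrite -mulrDr pmulr_rge0 ?invr_gt0 // => i3.
have : l2norm (p' - p) ^+ 2 <= dot (y - x) (p' - p).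
  rewrite l2norm_sqr -subr_ge0; apply: ge0_eq i3.
  by rewrite !dotE (dotC p' p); ring.
have := dot_le (y - x) (p' - p); have := l2norm_ge0 (p' - p).
have := l2norm_ge0 (y - x); set N := l2norm _; set M := l2norm _.
by move: (dot _ _) => d N0 M0 d1 d2; rewrite leNgt; apply/negP; nra.
Qed.

End Prox.

(** * First-order expansion of the forward-backward envelope *)

Section Smooth.
Context {R : realType} {n : nat}.
Variables (f : 'rV[R]_n -> R) (Lf : R).
Hypotheses (f_diff : forall x, differentiable f x)
  (f_Lip : forall x z, l2norm (grad f x - grad f z) <= Lf * l2norm (x - z)).
Implicit Types x y d : 'rV[R]_n.

Lemma derive_grad x d : 'D_d f x = dot (grad f x) d.
Proof.
rewrite deriveE // {1}(row_sum_delta d) linear_sum /=.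
by apply: eq_bigr => i _; rewrite linearZ /= mxE /partial deriveE // [RHS]mulrC.
Qed.

Lemma is_derive_segment x d (s : R) :
  is_derive s 1 (fun s => f (x + s *: d)) (dot (grad f (x + s *: d)) d).
Proof.
have e : (fun k : R => k^-1 *: (f (x + (k *: 1 + s) *: d) - f (x + s *: d))) =
         (fun k : R => k^-1 *: (f (k *: d + (x + s *: d)) - f (x + s *: d))).
  apply/funext => k; congr (_ *: (f _ - _)).
  by apply/rowP => i; rewrite !mxE /GRing.scale /=; ring.
split.
  by rewrite /derivable /= e; exact: diff_derivable.
by rewrite -derive_grad /derive /= e.
Qed.

(** This is the mean value theorem for [s |-> f (x + s d) - s <grad f x, d> - b s^2 / 2]. *)
Lemma quadratic_taylor x d (b : R) : exists2 c : R, 0 < c < 1 &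
  f (x + d) - f x - dot (grad f x) d - b / 2
    = dot (grad f (x + c *: d) - grad f x) d - b * c.
Proof.
pose phi s := f (x + s *: d) - (s * dot (grad f x) d + b / 2 * s ^+ 2).
pose dphi s := dot (grad f (x + s *: d)) d - (dot (grad f x) d + b * s).
have dphiP (s : R) : is_derive s 1 phi (dphi s).
  apply: is_deriveB; first exact: is_derive_segment.
  apply: is_derive_eq.
  by rewrite /GRing.scale /=; field.
have phi_cont : {within `[0, 1], continuous phi}.
  by apply: derivable_within_continuous => s _; have [] := dphiP s.
have [c c01 phiE] := MVT ltr01 (fun s _ => dphiP s) phi_cont.
exists c; first by move: c01; rewrite in_itv.
move: phiE; rewrite /phi /dphi scale1r scale0r addr0 dotDl dotNl => phiE.
lra.
Qed.

(** In [quadratic_taylor] the choice [b = +/- Lf |y - x|^2] gives the right-hand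
    side a sign. *)
Lemma lipschitz_grad_quadratic x y :
  `|f y - f x - dot (grad f x) (y - x)| <= Lf / 2 * dot (y - x) (y - x).
Proof.
set d := y - x; have -> : y = x + d by rewrite /d addrC subrK.
have bound c : 0 < c < 1 ->
    `|dot (grad f (x + c *: d) - grad f x) d| <= Lf * dot d d * c.
  move=> /andP[c0 _]; apply: (le_trans (ler_dot_norm _ _)).
  have := f_Lip (x + c *: d) x.
  rewrite [x + _]addrC addrK l2normZ gtr0_norm // => h.
  have := ler_wpM2r (l2norm_ge0 d) h; move/le_trans; apply.
  by rewrite -l2norm_sqr le_eqVlt; apply/orP; left; apply/eqP; ring.
rewrite ler_norml; apply/andP; split.
  have [c c01 e] := quadratic_taylor x d (- (Lf * dot d d)).
  have := bound c c01; rewrite ler_norml => /andP[+ _].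
  by move: e; move: (dot d d) (dot (_ - _) d) => A B; lra.
have [c c01 e] := quadratic_taylor x d (Lf * dot d d).
have := bound c c01; rewrite ler_norml => /andP[_].
by move: e; move: (dot d d) (dot (_ - _) d) => A B; lra.
Qed.

End Smooth.

Section Envelope.
Context {R : realType} {n : nat}.
Variables (f : 'rV[R]_n -> R) (h : 'rV[R]_n -> \bar R) (Lf lambda : R).
Hypotheses (f_diff : forall x, differentiable f x) (Lf_gt0 : 0 < Lf)
  (f_Lip : forall x z, l2norm (grad f x - grad f z) <= Lf * l2norm (x - z))
  (h_proper : proper_fun h) (h_lsc : lower_semicontinuous h)
  (h_convex : econvex h)
  (lambda_gt0 : 0 < lambda) (lambda_lt : lambda < 1 / Lf).
Implicit Types x y z d : 'rV[R]_n.

Local Notation g := (grad f).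
Local Notation H := (residual f h lambda).
Local Notation P := (fun x => prox lambda h (x - lambda *: grad f x)).

(** Smooth part of the model of which the envelope is the minimum over [z]. *)
Definition fb_model x z : R :=
  f x + dot (g x) (z - x) + (2 * lambda)^-1 * dot (z - x) (z - x).

(** Real-valued form of the envelope, which is finite everywhere. *)
Definition fbe x : R := fb_model x (P x) + fine (h (P x)).

Lemma fb_step_fin x : h (P x) = (fine (h (P x)))%:E.
Proof.
by have [a ->] := prox_fin h_proper h_lsc h_convex lambda_gt0 (x - lambda *: g x).
Qed.

Lemma lambda_neq0 : lambda != 0. Proof. by rewrite gt_eqF. Qed.

(** Completing the square: [fb_model] is the proximal objective at the forward
    step up to a term that depends on [x] only. *)
Lemma prox_objective_model x z :
  (2 * lambda)^-1 * l2norm (z - (x - lambda *: g x)) ^+ 2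
  = fb_model x z - f x + lambda / 2 * dot (g x) (g x).
Proof.
rewrite l2norm_sqr /fb_model opprB addrCA addrC -/(_ - _).
move: (z - x) (g x) => w u; rewrite !dotE (dotC w u).
by field; exact: lambda_neq0.
Qed.

Lemma fb_envelopeE x : fb_envelope f h lambda x = (fbe x)%:E.
Proof.
rewrite /fb_envelope /moreau fb_step_fin prox_objective_model l2norm_sqr.
by rewrite -!EFinD /fbe; congr (_%:E); ring.
Qed.

Lemma fbe_le_model x z s : h z = s%:E -> fbe x <= fb_model x z + s.
Proof.
move=> hz.
have := prox_argmin h_proper h_lsc h_convex lambda_gt0 (x - lambda *: g x).
rewrite /argmin /= => /(_ z).
rewrite hz fb_step_fin !prox_objective_model -!EFinD lee_fin /fbe.
by move: (fine _) (fb_model _ _) (fb_model _ _) (dot _ _) => A B C D; lra.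
Qed.

Lemma fb_stepE x : P x = x - lambda *: H x.
Proof.
by rewrite /residual scalerA divff ?lambda_neq0 // scale1r subKr.
Qed.

(** [fbe] is a minimum of models, so that the model of [x] at its minimizer,
    moved to [y], bounds [fbe y] from above. *)
Lemma fbe_upper x y :
  fbe y - fbe x <= dot (H x) (y - x) - lambda * dot (g y - g x) (H x)
    + (Lf / 2 + (2 * lambda)^-1) * dot (y - x) (y - x).
Proof.
have := fbe_le_model y (fb_step_fin x).
have -> : fbe x = fb_model x (P x) + fine (h (P x)) by [].
rewrite /fb_model fb_stepE.
have := lipschitz_grad_quadratic f_diff f_Lip y x.
rewrite ler_norml => /andP[+ _].
move: (fine _) (fbe y) => a F.
set d := y - x.
have -> : x - y = - d by rewrite /d opprB.
have -> : x - lambda *: H x - y = - (lambda *: H x + d).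
  by apply/rowP => i; rewrite /d !mxE; ring.
have -> : x - lambda *: H x - x = - (lambda *: H x).
  by apply/rowP => i; rewrite !mxE; ring.
move: d (H x) (g x) (g y) => d r u v.
rewrite !dotE (dotC d r).
move: (f x) (f y) (dot r d) (dot u r) (dot v r) (dot v d) (dot d d) (dot r r).
move=> A B C D E K M N.
have -> : (2 * lambda)^-1 * - (lambda * - (lambda * N + C) - (lambda * C + M))
    = lambda / 2 * N + C + (2 * lambda)^-1 * M.
  by field; exact: lambda_neq0.
have -> : (2 * lambda)^-1 * - (lambda * - (lambda * N)) = lambda / 2 * N.
  by field; exact: lambda_neq0.
lra.
Qed.

(** The forward step is Lipschitz and the proximal map is nonexpansive. *)
Lemma residual_lipschitz x y :
  l2norm (H y - H x) <= (2 / lambda + Lf) * l2norm (y - x).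
Proof.
rewrite /residual -scalerBr l2normZ ger0_norm ?invr_ge0 ?(ltW lambda_gt0) //.
set p := prox _ _ _; set p' := prox _ _ _.
have pp : l2norm (p - p') <= l2norm (y - x) + lambda * (Lf * l2norm (y - x)).
  apply: le_trans (prox_nonexpansive h_proper h_lsc h_convex lambda_gt0 _ _) _.
  have -> : y - lambda *: g y - (x - lambda *: g x)
          = (y - x) - lambda *: (g y - g x).
    by apply/rowP => i; rewrite !mxE; ring.
  apply: le_trans (l2norm_sub _ _) _; rewrite lerD2l l2normZ gtr0_norm //.
  by rewrite ler_wpM2l // ltW.
move: p p' pp => p p' pp.
have -> : y - p - (x - p') = (y - x) - (p - p').
  by apply/rowP => i; rewrite !mxE; ring.
rewrite mulrC ler_pdivrMr //.
have := l2norm_sub (y - x) (p - p').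
have -> : (2 / lambda + Lf) * l2norm (y - x) * lambda
        = 2 * l2norm (y - x) + lambda * (Lf * l2norm (y - x)).
  by field; exact: lambda_neq0.
move: pp; move: (l2norm _) (l2norm _) (l2norm _) => A B C; lra.
Qed.

(** Exchanging [x] and [y] in [fbe_upper] gives the lower bound, up to the
    variation of [H]. When [f] is twice differentiable the expansion says that
    the gradient of [fbe] is [(I - lambda * Hess f) H]. *)
Lemma fbe_expansion : exists2 C : R, 0 <= C & forall x y,
  `|fbe y - fbe x - (dot (H x) (y - x) - lambda * dot (g y - g x) (H x))|
    <= C * l2norm (y - x) ^+ 2.
Proof.
have vec s r u d : dot (s + r) (- d) - lambda * dot (- u) (s + r)
    = - dot s d - dot r d + lambda * dot u s + lambda * dot u r.
  by rewrite !dotE; ring.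
pose K := 2 / lambda + Lf; pose C1 := Lf / 2 + (2 * lambda)^-1.
have K0 : 0 <= K by rewrite addr_ge0 ?divr_ge0 // ltW.
have C10 : 0 <= C1 by rewrite addr_ge0 ?divr_ge0 ?invr_ge0 ?mulr_ge0 // ltW.
have lK0 : 0 <= lambda * Lf * K by rewrite !mulr_ge0 // ltW.
exists (C1 + (K + lambda * Lf * K)) => [|x y]; first by rewrite addr_ge0 // addr_ge0.
rewrite ler_norml; apply/andP; split; last first.
  have := fbe_upper x y; rewrite -/C1 -l2norm_sqr => up.
  have : 0 <= (K + lambda * Lf * K) * l2norm (y - x) ^+ 2.
    by apply: mulr_ge0; [exact: addr_ge0 | exact: sqr_ge0].
  rewrite [(C1 + _) * _]mulrDl.
  by move: up; move: (_ * l2norm _ ^+ 2) (_ * l2norm _ ^+ 2) (fbe _) (fbe _)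
    (dot _ _) (lambda * _) => A B D E F G; lra.
have := fbe_upper y x; rewrite -/C1 -l2norm_sqr (l2normB x y).
have -> : x - y = - (y - x) by rewrite opprB.
have -> : g x - g y = - (g y - g x) by rewrite opprB.
have := residual_lipschitz x y; rewrite -/K => HK.
have := f_Lip y x => gL.
have e1 := ler_dot_norm (H y - H x) (y - x).
have e2 := ler_dot_norm (g y - g x) (H y - H x).
have N0 := l2norm_ge0 (y - x).
have e1' : `|dot (H y - H x) (y - x)| <= K * l2norm (y - x) ^+ 2.
  apply: le_trans e1 _; rewrite expr2 mulrA ler_wpM2r //.
have e2' : lambda * `|dot (g y - g x) (H y - H x)|
    <= lambda * Lf * K * l2norm (y - x) ^+ 2.
  rewrite -!mulrA ler_wpM2l ?(ltW lambda_gt0) //; apply: le_trans e2 _.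
  have -> : Lf * (K * l2norm (y - x) ^+ 2) = (Lf * l2norm (y - x)) * (K * l2norm (y - x)).
    by ring.
  by rewrite ler_pM ?l2norm_ge0.
have -> : H y = H x + (H y - H x) by rewrite addrC subrK.
move: e1' e2'; rewrite -[lambda in lambda * `|_|]gtr0_norm // -normrM !ler_norml.
rewrite vec => /andP[a1 a2] /andP[b1 b2].
move: a1 a2 b1 b2; move: (dot (H y - H x) (y - x)) => r1.
move: (lambda * dot (g y - g x) (H y - H x)) => r2.
move: (dot (H x) (y - x)) (lambda * dot (g y - g x) (H x)) => s1 s2.
move: (fbe x) (fbe y) (l2norm (y - x) ^+ 2) => F1 F2 N a1 a2 b1 b2.
clearbody K C1; lra.
Qed.

Lemma step_lt1 : lambda * Lf < 1.
Proof. by move: lambda_lt; rewrite ltr_pdivlMr. Qed.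

(** At a minimizer of the envelope the forward-backward step cannot decrease
    it, hence is stationary; there the envelope agrees with [f + h], of which it
    is a lower bound elsewhere. *)
Lemma argmin_fbe_minimizers x :
  (forall y, fbe x <= fbe y) -> minimizers f h x.
Proof.
move=> xmin.
have dec : fbe (P x) <= f (P x) + fine (h (P x)).
  have := fbe_le_model (P x) (fb_step_fin x).
  by rewrite /fb_model subrr dotC !dot0l mulr0 !addr0.
have Px : P x = x.
  apply/eqP; rewrite -subr_eq0; apply/eqP/l2norm_eq0/eqP.
  rewrite -sqrf_eq0 l2norm_sqr eq_le dot_ge0 andbT.
  have := lipschitz_grad_quadratic f_diff f_Lip x (P x).
  rewrite ler_norml => /andP[_].
  have := xmin (P x) => /le_trans /(_ dec); rewrite {1}/fbe /fb_model.
  set w := _ - x; move: (dot w w) (dot_ge0 w) => q q0.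
  move: (f (P x)) (f x) (fine _) (dot _ _) => A B E D i1 i2.
  have i3 : ((2 * lambda)^-1 - Lf / 2) * q <= 0 by lra.
  have : 0 < (2 * lambda)^-1 - Lf / 2.
    rewrite subr_gt0 -(@ltr_pM2l _ (2 * lambda)) ?mulr_gt0 //.
    rewrite divff ?mulf_neq0 ?lambda_neq0 ?pnatr_eq0 //.
    by have := step_lt1; lra.
  by move: i3 => /[swap] c0; rewrite pmulr_rle0.
have hx := fb_step_fin x; have := xmin; rewrite {1}/fbe /fb_model.
rewrite Px in hx *; rewrite subrr dotC !dot0l mulr0 !addr0 => xmin' y.
have [hN _] := h_proper.
rewrite hx; case hy : (h y) (hN y) => [s| |] // _; last by rewrite addey // leey.
rewrite -!EFinD lee_fin; apply: le_trans (xmin' y) _.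
by have := fbe_le_model y hy; rewrite /fb_model subrr dotC !dot0l mulr0 !addr0.
Qed.

End Envelope.

(** * Absolutely continuous functions with bounded slope *)

Section UpperSlope.
Context {R : realType}.
Implicit Types (g G V : R -> R) (t c : R).

(** [c] bounds the difference quotients of [g] from above, in the limit, on both
    sides of [t]; the factor [u - t] puts both sides in one formula. *)
Definition upper_slope g t c := forall e : R, 0 < e ->
  \forall u \near t, (g u - g t) * (u - t) <= (c + e) * (u - t) ^+ 2.

Lemma is_derive_near (W : normedModType R) (x : R -> W) (t : R) (v : W) :
  is_derive t 1 x v -> forall e : R, 0 < e ->
  \forall u \near t, `|x u - x t - (u - t) *: v| <= e * `|u - t|.
Proof.
move=> [/cvg_ex[/= l xl] <-] e e0.
have -> : 'D_1 x t = l by apply: cvg_lim.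
move/cvgrPdist_le : xl => /(_ e e0) /nbhs_ballP[r /= r0 xr].
apply/nbhs_ballP; exists r => //= u; rewrite -ball_normE /= => ut.
have [->|neq] := eqVneq u t.
  by rewrite !subrr scale0r subr0 !normr0 mulr0.
have ut0 : u - t != 0 by rewrite subr_eq0.
have := xr (u - t); rewrite -ball_normE /= sub0r normrN distrC => /(_ ut ut0).
have -> : (u - t) *: 1 + t = u by rewrite /GRing.scale /= mulr1 subrK.
move=> le_e.
have -> : x u - x t - (u - t) *: l
    = - ((u - t) *: (l - (u - t)^-1 *: (x u - x t))).
  by rewrite scalerBr scalerA divff // scale1r opprB.
by rewrite normrN normrZ (distrC t) mulrC ler_wpM2r.
Qed.

Lemma upper_slope_le g t c c' : c <= c' -> upper_slope g t c -> upper_slope g t c'.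
Proof.
move=> cc' gt e e0; apply: filterS (gt e e0) => u; move/le_trans; apply.
by rewrite ler_wpM2r ?sqr_ge0 // lerD2r.
Qed.

Lemma upper_slope_subl g t c :
  upper_slope g t c -> upper_slope (fun u => g u - c * u) t 0.
Proof.
move=> gt e e0; apply: filterS (gt e e0) => u.
rewrite -subr_ge0 => ?; rewrite -subr_ge0; apply: le_trans (_ : _ <= _); first eassumption.
by rewrite le_eqVlt; apply/orP; left; apply/eqP; ring.
Qed.

(** A slope bound compares [V] with a line; the monotone [G] preserves the
    comparison, and [G] along a line is differentiable. *)
Lemma upper_slope_comp G V t c dG :
  upper_slope V t c -> (\forall u \near t, 0 < V u) ->
  is_derive (V t) 1 G dG -> 0 <= dG ->
  (forall y z, 0 < y -> y <= z -> G y <= G z) ->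
  upper_slope (G \o V) t (dG * c).
Proof.
move=> Vt Vpos Gd dG0 Gmono e e0.
pose eta := e / (2 * (dG + 1)).
have eta0 : 0 < eta by rewrite divr_gt0 // mulr_gt0 //; lra.
have dGeta : dG * eta <= e / 2.
  rewrite /eta mulrA ler_pdivrMr; last by rewrite mulr_gt0 //; lra.
  by have := ltW e0; nra.
pose c' := c + eta; pose eps := e / (2 * (`|c'| + 1)).
have nc' := normr_ge0 c'.
have eps0 : 0 < eps by rewrite divr_gt0 // mulr_gt0 //; lra.
have epsc : eps * `|c'| <= e / 2.
  rewrite /eps mulrAC ler_pdivrMr; last by rewrite mulr_gt0 //; lra.
  by have := ltW e0; nra.
have line : (fun u => V t + c' * (u - t)) @ t --> V t.
  have : (fun u => V t + c' * (u - t)) @ t --> V t + c' * (t - t).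
    apply: cvgD; first exact: cvg_cst.
    apply: cvgM; first exact: cvg_cst.
    by apply: cvgB; [exact: cvg_id|exact: cvg_cst].
  by rewrite subrr mulr0 addr0.
have Gline : \forall u \near t, `|G (V t + c' * (u - t)) - G (V t)
    - (V t + c' * (u - t) - V t) *: dG| <= eps * `|V t + c' * (u - t) - V t|.
  exact: line _ (is_derive_near Gd eps0).
have Vt0 : 0 < V t by exact: nbhs_singleton Vpos.
near=> u.
have Vu : (V u - V t) * (u - t) <= c' * (u - t) ^+ 2 by near: u; exact: Vt.
have Vu0 : 0 < V u by near: u.
pose y := V t + c' * (u - t).
have y0 : 0 < y by rewrite /y; near: u; move/cvgr_gt: line; apply.
have Gy : `|G y - G (V t) - (y - V t) * dG| <= eps * `|y - V t|.
  by rewrite /y; near: u; exact: Gline.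
have yV : y - V t = c' * (u - t) by rewrite /y addrAC subrr add0r.
move: Gy; rewrite yV normrM => Gy.
have {}Gy : `|G y - G (V t) - dG * c' * (u - t)| <= e / 2 * `|u - t|.
  have -> : dG * c' * (u - t) = c' * (u - t) * dG by ring.
  apply: le_trans Gy _; rewrite mulrA ler_wpM2r //.
have slope : dG * c' <= dG * c + e / 2 by rewrite /c' mulrDr lerD2l.
have [ut|tu|->] := ltgtP u t; last by rewrite !subrr mul0r expr0n mulr0.
- have s0 : u - t < 0 by rewrite subr_lt0.
  have yVu : y <= V u.
    have : (V u - y) * (u - t) <= 0.
      by rewrite /y; move: Vu; clear; move: (u - t) => s; lra.
    by rewrite nmulr_lle0 // subr_ge0.
  have := Gmono _ _ y0 yVu.
  move: Gy; rewrite [`|u - t|]ltr0_norm // ler_norml => /andP[+ _] /=.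
  move: slope s0; clear; move: (u - t) (dG * c') (dG * c) (G y) (G (V u)) => s A B C D.
  move=> AB s0 h1 h2; rewrite expr2 mulrA ler_nM2r //.
  by have := ltW s0; nra.
- have s0 : 0 < u - t by rewrite subr_gt0.
  have yVu : V u <= y.
    have : (V u - y) * (u - t) <= 0.
      by rewrite /y; move: Vu; clear; move: (u - t) => s; lra.
    by rewrite pmulr_lle0 // subr_le0.
  have := Gmono _ _ Vu0 yVu.
  move: Gy; rewrite [`|u - t|]gtr0_norm // ler_norml => /andP[_] /=.
  move: slope s0; clear; move: (u - t) (dG * c') (dG * c) (G y) (G (V u)) => s A B C D.
  move=> AB s0 h1 h2; rewrite expr2 mulrA ler_pM2r //.
  by have := ltW s0; nra.
Unshelve. all: by end_near. Qed.

End UpperSlope.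

Section AbsoluteContinuity.
Context {R : realType}.
Implicit Types (a b : R) (l : seq (R * R)) (D : R -> R -> R).

(** Intervals are listed from right to left, so that a list grows at its head
    as time advances. *)
Fixpoint packed a b l : Prop :=
  if l is J :: l' then [/\ J.1 <= J.2, J.2 <= b & packed a J.1 l'] else a <= b.

Definition interval_sum D l : R := \sum_(J <- l) D J.1 J.2.

(** The notion is defined for interval functions [D s t], so that it applies
    alike to the increments of scalar functions, with [D s t = `|g t - g s|], and
    of curves, with the Euclidean norm. *)
Definition abs_cont D a b := forall e : R, 0 < e -> exists2 d : R, 0 < d &
  forall l, packed a b l -> interval_sum (fun s t => t - s) l < d -> interval_sum D l < e.

Lemma packed_le a b l : packed a b l -> a <= b.
Proof. by elim: l b => //= I l IH b [le12 leb /IH]; lra. Qed.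

Lemma packed_widen a b b' l : b <= b' -> packed a b l -> packed a b' l.
Proof.
by case: l => [|I l] /= bb' => [ab|[? I2 ?]]; [lra | split=> //; lra].
Qed.

Lemma packed_widenl a a' b l : a' <= a -> packed a b l -> packed a' b l.
Proof.
by move=> aa'; elim: l b => /= [b|I l IH b [? ? /IH]]; [lra | split].
Qed.

Lemma packed_mem a b l I :
  packed a b l -> I \in l -> [/\ a <= I.1, I.1 <= I.2 & I.2 <= b].
Proof.
elim: l b => //= J l IH b [le12 leb pl]; rewrite in_cons => /orP[/eqP->|/IH].
  by split=> //; exact: packed_le pl.
by move=> /(_ _ pl)[? ? ?]; split=> //; lra.
Qed.

Lemma abs_cont_dominated K D D' a b : 0 <= K ->
  (forall s t, a <= s -> s <= t -> t <= b -> D' s t <= K * D s t) ->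
  abs_cont D a b -> abs_cont D' a b.
Proof.
move=> K0 DD' acD e e0.
have [d d0 dD] := acD (e / (K + 1)) (divr_gt0 e0 (ltr_pwDr ltr01 K0)).
exists d => // l pl /(dD l pl) lD.
have : interval_sum D' l <= K * interval_sum D l.
  rewrite /interval_sum big_distrr /= big_seq [leRHS]big_seq.
  by apply: ler_sum => I /(packed_mem pl)[? ? ?]; exact: DD'.
have : (K + 1) * interval_sum D l < e by rewrite mulrC -ltr_pdivlMr //; lra.
move: lD; have [t0|t0] := leP 0 (interval_sum D l); first by lra.
move: (interval_sum D l) t0 => A; nra.
Qed.

Lemma abs_cont_add_length K D a b : 0 <= K ->
  abs_cont D a b -> abs_cont (fun s t => D s t + K * (t - s)) a b.
Proof.
move=> K0 acD e e0.
have [d d0 dD] := acD (e / 2) ltac:(lra).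
have dK0 : 0 < e / (2 * (K + 1)) by rewrite divr_gt0 // mulr_gt0 //; lra.
exists (Num.min d (e / (2 * (K + 1)))) => [|l pl]; first by rewrite lt_min d0.
rewrite lt_min => /andP[/(dD l pl) l1 l2].
rewrite /interval_sum big_split -big_distrr /= -/(interval_sum _ _).
have l0 : 0 <= interval_sum (fun s t => t - s) l.
  rewrite /interval_sum big_seq; apply: sumr_ge0 => I /(packed_mem pl)[? ? ?]; lra.
move: l2; rewrite ltr_pdivlMr ?mulr_gt0 //; last by lra.
rewrite -/(interval_sum (fun s t => t - s) l).
move: l0 l1; move: (interval_sum D l) (interval_sum _ l) => A B; nra.
Qed.

Lemma packed_measure (U : set R) a b l : measurable U -> packed a b l ->
  (forall I, I \in l -> `[I.1, I.2] `<=` U) ->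
  ((interval_sum (fun s t => t - s) l)%:E <= lebesgue_measure (U `&` `]-oo, b[))%E.
Proof.
move=> mU; elim: l b => [|I l IH] b /=.
  by move=> _ _; rewrite /interval_sum big_nil.
move=> [le12 leb pl] lU.
rewrite /interval_sum big_cons EFinD addeC -/(interval_sum _ l).
have lU' J : J \in l -> `[J.1, J.2] `<=` U.
  by move=> Jl; apply: lU; rewrite in_cons Jl orbT.
apply: (@le_trans _ _ (lebesgue_measure (U `&` `]-oo, I.1[)
    + lebesgue_measure (`[I.1, I.2[ : set R))%E).
  apply: leeD; first exact: IH.
  rewrite lebesgue_measure_itv /= lte_fin.
  by case: ltP => // h; rewrite lee_fin; lra.
rewrite -measureU //; first last.
- apply/seteqP; split => // x /= [[_]]; rewrite !in_itv /= => h1 /andP[h2 _]; lra.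
- exact: measurableI.
apply: le_measure; rewrite ?inE; [by apply: measurableU => //; exact: measurableI
  | exact: measurableI | ].
move=> x [[Ux]|]; rewrite /= !in_itv /=.
  by move=> xI; split=> //; lra.
move=> /andP[h1 h2]; split; last by lra.
by apply: (lU I); [exact: mem_head|rewrite /= in_itv /= h1 ltW].
Qed.

(** The standard covering argument. Exceptional times lie in an open set [U] of
    small measure, so that the increments of [g] over disjoint intervals of [U]
    are small in total; at the other times the slope bound holds nearby. The
    times up to which [g] is controlled by these two contributions have [b] as
    their supremum. *)
Lemma abs_cont_nonincreasing (g : R -> R) a b : a <= b ->
  abs_cont (fun s t => `|g t - g s|) a b ->
  {ae @lebesgue_measure R, forall t : R, a < t -> t < b -> upper_slope g t 0} ->
  g b <= g a.
Proof.
move=> ab acg [A [mA A0 badA]].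
apply/ler_addgt0Pr => e e0.
have [d d0 dg] := acg (e / 2) ltac:(lra).
pose eps := e / (2 * (b - a + 1)).
have eps0 : 0 < eps by rewrite divr_gt0 // mulr_gt0 //; lra.
have epsab : eps * (b - a) <= e / 2.
  rewrite /eps mulrAC ler_pdivrMr; last by rewrite mulr_gt0 //; lra.
  by have := ltW e0; nra.
(* the endpoints count as exceptional: the slope bound holds inside only *)
pose B := A `|` ([set a] `|` [set b]).
have mab : measurable ([set a] `|` [set b]).
  by apply: measurableU; exact: measurable_set1.
have mB : measurable B by exact: measurableU.
have B0 : lebesgue_measure B = 0%E.
  have ab0 : lebesgue_measure ([set a] `|` [set b]) = 0%E.
    by apply: countable_lebesgue_measure0; exact: finite_set_countable.
  by rewrite /B (measureU0 mA mab ab0).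
have Boo : (lebesgue_measure B < +oo)%E by rewrite B0 ltry.
have [U [oU BU mUB]] := lebesgue_regularity_outer mB Boo d0.
have mU : measurable U by exact: measurable_realfun.open_measurable.
have Ud : (lebesgue_measure U < d%:E)%E.
  apply: le_lt_trans mUB; rewrite -[leRHS]add0e -[X in (X + _)%E]B0 -measureU //.
  - by rewrite setDUK.
  - exact: measurableD.
  - by rewrite setDIK.
have short l t : packed a t l -> (forall I, I \in l -> `[I.1, I.2] `<=` U) ->
    interval_sum (fun s t => t - s) l < d.
  move=> pl lU; rewrite -lte_fin; apply: le_lt_trans Ud.
  apply: le_trans (packed_measure mU pl lU) _.
  by apply: le_measure; rewrite ?inE //; exact: measurableI.
pose D s t := `|g t - g s|.
pose S := [set t | a <= t <= b /\ exists l, [/\ packed a t l,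
  forall I, I \in l -> `[I.1, I.2] `<=` U &
  g t - g a <= eps * (t - a) + interval_sum D l]].
have Sa : S a.
  split; first by rewrite lexx.
  by exists [::]; split => //=; rewrite /interval_sum big_nil !subrr mulr0 addr0.
have supS : has_sup S by split; [exists a | exists b => t [/andP[]]].
set sg := sup S.
have asg : a <= sg by apply: sup_upper_bound.
have sgb : sg <= b by apply: ge_sup; [exists a | move=> t [/andP[]]].
have [r r0 step] : exists2 r : R, 0 < r & forall u v, S u -> u <= sg -> sg <= v ->
    v <= b -> sg - r < u -> v < sg + r -> S v.
  have [Bsg|nB] := pselect (B sg).
    have /nbhs_ballP[r /= r0 rU] : nbhs sg U by apply: open_nbhs_nbhs; split => //; exact: BU.
    exists r => // u v [/andP[au _] [l [pl lU gl]]] us sv vb ur vr.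
    have uv : u <= v by lra.
    split; first by apply/andP; split => //; lra.
    exists ((u, v) :: l); split => /=.
    - by split.
    - move=> I; rewrite in_cons => /orP[/eqP-> x /=|]; last exact: lU.
      rewrite in_itv /= => /andP[ux xv]; apply: rU; rewrite -ball_normE /=.
      by rewrite ltr_norml; lra.
    - rewrite /interval_sum big_cons -/(interval_sum D l) /= /D.
      have := ler_norm (g v - g u).
      have : eps * (u - a) <= eps * (v - a) by rewrite ler_wpM2l ?(ltW eps0) //; lra.
      by move: gl; rewrite /D; lra.
  have good : upper_slope g sg 0.
    have [a1 b1] : a < sg /\ sg < b.
      split; rewrite lt_neqAle ?asg ?sgb andbT; apply/negP => /eqP E; apply: nB;
      right; [left|right] => //=.
    by apply: contrapT => bad; apply: nB; left; apply: badA => /= /(_ a1 b1).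
  have /nbhs_ballP[r /= r0 rg] := good _ eps0.
  exists r => // u v [/andP[au _] [l [pl lU gl]]] us sv vb ur vr.
  split; first by apply/andP; split => //; lra.
  exists l; split => //; first by apply: packed_widen pl; lra.
  have gv : g v - g sg <= eps * (v - sg).
    have [->|vs] := eqVneq v sg; first by rewrite !subrr mulr0.
    have vs0 : 0 < v - sg by rewrite subr_gt0 lt_neqAle eq_sym vs.
    have := rg v; rewrite -ball_normE /= => h.
    have {h} := h ltac:(by rewrite ltr_norml; lra).
    by rewrite add0r expr2 mulrA ler_pM2r.
  have gu : g sg - g u <= eps * (sg - u).
    have [->|us'] := eqVneq u sg; first by rewrite !subrr mulr0.
    have us0 : u - sg < 0 by rewrite subr_lt0 lt_neqAle us'.
    have := rg u; rewrite -ball_normE /= => h.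
    have {h} := h ltac:(by rewrite ltr_norml; lra).
    by rewrite add0r expr2 mulrA ler_nM2r //; lra.
  by move: gv gu gl; move: (interval_sum D l) => T; lra.
have [u Su ur] := sup_adherent r0 supS.
have us : u <= sg by apply: sup_upper_bound.
(* a time beyond sg, unless sg = b *)
pose v := Num.min b (sg + r / 2).
have Sv : S v.
  apply: (step u v) => //; rewrite /v; first by rewrite le_min sgb; lra.
    by rewrite ge_min lexx.
  by rewrite gt_min; apply/orP; right; lra.
have vs : v <= sg by apply: sup_upper_bound.
have vb : v = b.
  by move: vs; rewrite /v; case: (leP b (sg + r / 2)) => // _ h; exfalso; lra.
move: Sv; rewrite vb => -[_ [l [pl lU gl]]].
have := dg l pl (short l b pl lU).
by move: gl; rewrite -/D; lra.
Qed.

Lemma abs_cont_slope_le (g : R -> R) a b c : a <= b ->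
  abs_cont (fun s t => `|g t - g s|) a b ->
  {ae @lebesgue_measure R, forall t : R, a < t -> t < b -> upper_slope g t c} ->
  g b - g a <= c * (b - a).
Proof.
move=> ab acg slope.
have : g b - c * b <= g a - c * a.
  apply: (abs_cont_nonincreasing (g := fun u => g u - c * u) ab).
    apply: (@abs_cont_dominated 1) (abs_cont_add_length (normr_ge0 c) acg) => //.
    move=> s t as_ st tb; rewrite mul1r.
    have -> : g t - c * t - (g s - c * s) = (g t - g s) - c * (t - s) by ring.
    by rewrite (le_trans (ler_normB _ _)) // normrM [`|t - s|]ger0_norm ?subr_ge0.
  move: slope => [A [mA A0 badA]]; exists A; split => // t /= bad.
  apply: badA => /= slope; apply: bad => a_t tb.
  exact: upper_slope_subl (slope a_t tb).
lra.
Qed.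

End AbsoluteContinuity.

(** * Extinction in fixed time *)

Section FixedTime.
Context {R : realType}.

Lemma powR_nonincreasing (r y z : R) : r <= 0 -> 0 < y -> y <= z -> z `^ r <= y `^ r.
Proof.
move=> r0 y0 yz; have z0 : 0 < z by lra.
rewrite -[r]opprK (powRN z) (powRN y) lef_pV2 ?posrE ?powR_gt0 //.
by apply: ge0_ler_powR => //; rewrite ?nnegrE; lra.
Qed.

(** For every nonzero exponent [s <= 1] this is increasing and concave on the
    positive reals, with derivative [w `^ (s - 1)]. *)
Definition pow_primitive (s w : R) : R := w `^ s / s.

Lemma is_derive_pow_primitive (s w : R) : s != 0 -> 0 < w ->
  is_derive w 1 (pow_primitive s) (w `^ (s - 1)).
Proof.
move=> s0 w0; have d := is_derive1_powR s w0.
apply: is_derive_eq.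
by rewrite scaler0 add0r /GRing.scale /= mulrA mulVf // mul1r.
Qed.

Lemma pow_primitive_increment (s v y z : R) : s != 0 -> s <= 1 -> 0 < v -> v <= y -> y <= z ->
  0 <= pow_primitive s z - pow_primitive s y <= v `^ (s - 1) * (z - y).
Proof.
move=> s0 s1 v0 vy yz.
have [||w wyz ->] := @MVT_segment R (pow_primitive s) (fun w => w `^ (s - 1)) y z yz.
- move=> w; rewrite in_itv /= => /andP[yw _].
  by apply: is_derive_pow_primitive => //; lra.
- apply: derivable_within_continuous => w; rewrite in_itv /= => /andP[yw _].
  by have [] := is_derive_pow_primitive s0 (lt_le_trans v0 (le_trans vy yw)).
move: wyz; rewrite in_itv /= => /andP[yw wz].
rewrite mulr_ge0 ?powR_ge0 ?subr_ge0 //= ler_wpM2r ?subr_ge0 //.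
by apply: powR_nonincreasing => //; lra.
Qed.

Variables (W : R -> R) (c : R).
Hypotheses (W_ge0 : forall t, 0 <= W t) (c_gt0 : 0 < c)
  (W_ac : forall b, 0 <= b -> abs_cont (fun s t => `|W t - W s|) 0 b)
  (W_slope : {ae @lebesgue_measure R, forall t, 0 < t -> upper_slope W t 0}).

(** The exponent is written so that [r] is the power of [|H|] in the field, and
    the factor [2] is that of [W = 2 mu (F - m)] in the application. *)
Definition power_decay (k r : R) : Prop :=
  {ae @lebesgue_measure R, forall t, 0 < t -> 0 < W t ->
    upper_slope W t (- (2 * c * k * W t `^ ((1 + r) / 2)))}.

Lemma W_ac_sub a b : 0 <= a -> a <= b -> abs_cont (fun s t => `|W t - W s|) a b.
Proof.
move=> a0 ab e e0; have [d d0 dW] := W_ac (le_trans a0 ab) e0.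
by exists d => // l pl; apply: dW; exact: packed_widenl pl.
Qed.

Lemma W_nonincreasing s t : 0 <= s -> s <= t -> W t <= W s.
Proof.
move=> s0 st; apply: (abs_cont_nonincreasing st (W_ac_sub s0 st)).
move: W_slope => [A [mA A0 bad]]; exists A; split => // u /= nu.
by apply: bad => /= Wu; apply: nu => su _; apply: Wu; lra.
Qed.

(** The primitive linearizes the decay: its slope along [W] is constant. *)
Lemma pow_primitive_decay k r s t : 0 <= r -> r != 1 -> power_decay k r ->
  0 <= s -> s <= t -> 0 < W t ->
  pow_primitive ((1 - r) / 2) (W t) - pow_primitive ((1 - r) / 2) (W s)
    <= - (2 * c * k) * (t - s).
Proof.
move=> r0 r1 decay s0 st Wt0; set a := (1 - r) / 2.
have a0 : a != 0 by rewrite mulf_neq0 ?invr_neq0 ?pnatr_eq0 // subr_eq0 eq_sym.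
have a1 : a <= 1 by rewrite /a; lra.
have Wpos u : s <= u -> u <= t -> W t <= W u by move=> su ut; apply: W_nonincreasing; lra.
apply: (@abs_cont_slope_le _ (pow_primitive a \o W)) => //=.
  apply: (abs_cont_dominated (powR_ge0 (W t) (a - 1))) (W_ac_sub s0 st).
  move=> u v su uv vt.
  have vu := W_nonincreasing (le_trans s0 su) uv.
  have /andP[h1 h2] := pow_primitive_increment a0 a1 Wt0 (Wpos v (le_trans su uv) vt) vu.
  rewrite distrC ger0_norm // [`|W v - _|]distrC [`|W u - _|]ger0_norm //.
  by rewrite subr_ge0.
move: decay => [A [mA A0 bad]]; exists A; split => // u /= nu.
apply: bad => /= Wu; apply: nu => su ut.
have Wu0 : 0 < W u by have := Wpos u (ltW su) (ltW ut); lra.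
have -> : - (2 * c * k) = W u `^ (a - 1) * - (2 * c * k * W u `^ ((1 + r) / 2)).
  have -> : a - 1 = - ((1 + r) / 2) by rewrite /a; field.
  rewrite powRN; move: (powR_gt0 ((1 + r) / 2) Wu0) => P0.
  by rewrite mulrN mulrCA mulVf ?gt_eqF // mulr1.
apply: upper_slope_comp.
- by apply: Wu; lra.
- have : \forall v \near (u : R), v \in `]s, t[%R.
    by apply: near_in_itvoo; rewrite in_itv /= su.
  apply: filterS => v; rewrite in_itv /= => /andP[sv vt].
  by apply: lt_le_trans Wt0 _; apply: Wpos; exact: ltW.
- exact: is_derive_pow_primitive.
- exact: powR_ge0.
- move=> y z y0 yz; rewrite -subr_ge0.
  by have /andP[] := pow_primitive_increment a0 a1 y0 (lexx y) yz.
Qed.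

(** A power above one brings [W] below one in a time that does not depend on
    [W 0]; a power below one brings it from there to zero. *)
Lemma fixed_time_extinction p q kp kq : 0 <= p -> p < 1 -> 1 < q ->
  0 < kp -> 0 < kq -> power_decay kp p -> power_decay kq q ->
  forall t, 1 / c * (1 / (kp * (1 - p)) + 1 / (kq * (q - 1))) <= t -> W t = 0.
Proof.
move=> p0 p1 q1 kp0 kq0 decp decq t Tt.
pose T1 := 1 / c * (1 / (kq * (q - 1))); pose T2 := 1 / c * (1 / (kp * (1 - p))).
have q10 : 0 < q - 1 by lra.
have p10 : 0 < 1 - p by lra.
have T10 : 0 < T1 by rewrite !mulr_gt0 // ?invr_gt0 ?mulr_gt0.
have T20 : 0 < T2 by rewrite !mulr_gt0 // ?invr_gt0 ?mulr_gt0.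
have neq0 : [&& c != 0, kp != 0, kq != 0, q - 1 != 0 & 1 - p != 0].
  by rewrite !gt_eqF.
(* T1 is chosen so that W ^ ((1 - q) / 2), being at least its value at time 0
   plus one, exceeds one *)
have W1 : W T1 <= 1.
  rewrite leNgt; apply/negP => W1.
  have W1_0 : 0 < W T1 by lra.
  have W0_0 : 0 < W 0 by have := W_nonincreasing (lexx 0) (ltW T10); lra.
  have q_neq1 : q != 1 by rewrite gt_eqF.
  have := pow_primitive_decay (le_trans ler01 (ltW q1)) q_neq1 decq (lexx 0) (ltW T10) W1_0.
  rewrite /pow_primitive subr0; set a := (1 - q) / 2.
  have an : a < 0 by rewrite /a; lra.
  have -> : - (2 * c * kq) * T1 = a^-1.
    rewrite /T1 /a; field.
    by case/and5P: neq0 => -> _ -> h _; rewrite ?pnatr_eq0 -opprB oppr_eq0 h.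
  rewrite -mulrBl ler_ndivrMr // mulVf ?lt_eqF //.
  have := powR_gt0 a W0_0.
  have : W T1 `^ a <= 1 `^ a by apply: powR_nonincreasing; lra.
  by rewrite powR1; lra.
apply/eqP; rewrite eq_le W_ge0 andbT leNgt; apply/negP => Wt.
have T12 : T1 <= T1 + T2 by lra.
have W12 : 0 < W (T1 + T2).
  apply: lt_le_trans Wt _; apply: W_nonincreasing; first by lra.
  by move: Tt; rewrite mulrDr -/T1 -/T2 addrC.
have p_neq1 : p != 1 by rewrite lt_eqF.
have := pow_primitive_decay p0 p_neq1 decp (ltW T10) T12 W12.
rewrite /pow_primitive addrAC subrr add0r; set a := (1 - p) / 2.
have ap : 0 < a by rewrite /a; lra.
have -> : - (2 * c * kp) * T2 = - a^-1.
  rewrite /T2 /a; field.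
  by case/and5P: neq0 => -> -> _ _ ->; rewrite ?pnatr_eq0.
rewrite -mulrBl ler_pdivrMr // mulNr mulVf ?gt_eqF //.
have := powR_gt0 a W12.
have : W T1 `^ a <= 1 `^ a.
  by apply: ge0_ler_powR; rewrite ?nnegrE ?(ltW ap).
by rewrite powR1; lra.
Qed.

End FixedTime.

(** * Absolutely continuous curves *)

Section Curves.
Context {R : realType} {n : nat}.
Implicit Types (x : R -> 'rV[R]_n) (X : 'rV[R]_n -> 'rV[R]_n).

Definition curve_ac x b := abs_cont (fun s t => l2norm (x t - x s)) 0 b.

Lemma is_derive_l2norm x (t : R) v : is_derive t 1 x v -> forall e : R, 0 < e ->
  \forall u \near t, l2norm (x u - x t - (u - t) *: v) <= e * `|u - t|.
Proof.
move=> xt e e0.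
have e1 : 0 < e / n.+1%:R by rewrite divr_gt0 // ltr0n.
apply: filterS (is_derive_near xt e1) => u h.
apply: le_trans (l2norm_le_mx _) _.
apply: (@le_trans _ _ (n.+1%:R * `|x u - x t - (u - t) *: v|)).
  by rewrite ler_wpM2r // ler_nat.
by rewrite mulrC -ler_pdivlMr ?ltr0n // mulrAC.
Qed.

(** On steps of half the length given by absolute continuity for increments
    below [1], the curve moves by at most [1]. *)
Lemma curve_ac_bounded x b : curve_ac x b ->
  exists M, forall t, 0 <= t -> t <= b -> l2norm (x t - x 0) <= M.
Proof.
move=> acx; have [d d0 dx] := acx 1 ltr01.
have bound k t : 0 <= t -> t <= b -> t <= k%:R * (d / 2) -> l2norm (x t - x 0) <= k%:R.
  elim: k t => [|k IH] t t0 tb.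
    by rewrite mul0r => t0'; rewrite (_ : t = 0) ?subrr ?l2norm0 //; lra.
  rewrite -natr1 mulrDl mul1r => tk.
  pose s := Num.max 0 (t - d / 2).
  have s0 : 0 <= s by rewrite le_max lexx.
  have st : s <= t by rewrite ge_max t0; lra.
  have sd : t - d / 2 <= s by rewrite le_max lexx orbT.
  have sk : s <= k%:R * (d / 2).
    by rewrite ge_max mulr_ge0 ?divr_ge0 ?(ltW d0) //=; lra.
  have := IH s s0 (le_trans st tb) sk.
  have := dx [:: (s, t)]; rewrite /interval_sum !big_seq1 /= => h.
  have {}h : l2norm (x t - x s) < 1 by apply: h => //; lra.
  have := l2normD (x t - x s) (x s - x 0); rewrite addrA subrK.
  by move: h; move: (l2norm _) (l2norm _) (l2norm _) (k%:R) => A B C K; lra.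
have [b0|b0] := leP 0 b; last by exists 0 => t t0 tb; exfalso; lra.
exists (Num.bound (b / (d / 2)))%:R => t t0 tb; apply: bound => //.
apply: (le_trans tb); rewrite -ler_pdivrMr; last by lra.
by apply: ltW; apply: archi_boundP; rewrite divr_ge0 //; lra.
Qed.

Lemma packed_nth (a b : R) l i j : packed a b l -> (i < j < size l)%N ->
  (nth (0, 0) l j).2 <= (nth (0, 0) l i).1.
Proof.
elim: l b i j => [|J l IH] b i j; first by rewrite ltn0 andbF.
move=> /= [J12 Jb pl]; case: j => [|j]; first by rewrite ltn0.
case: i => [|i] /=; rewrite !ltnS; last exact: IH pl.
move=> jl; have jl' : nth (0, 0) l j \in l by exact: mem_nth.
by have [_ _] := packed_mem pl jl'.
Qed.

Lemma absolutely_continuous_curve x b : absolutely_continuous 0 b x -> curve_ac x b.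
Proof.
move=> acx e e0; have [d d0 dx] := acx e e0; exists d => // l pl.
have := dx (size l) (fun i => (nth (0, 0) l i).1) (fun i => (nth (0, 0) l i).2).
rewrite /interval_sum !(big_nth (0, 0)) !big_mkord.
apply=> [i|i j ij].
  by have [] := packed_mem pl (mem_nth (0, 0) (ltn_ord i)).
have [lt|lt|eq] := ltngtP i j; last by move/val_inj: eq ij => ->; rewrite eqxx.
- by right; apply: packed_nth pl _; rewrite lt /=.
- by left; apply: packed_nth pl _; rewrite lt /=.
Qed.

Lemma dot_cvg (w : 'rV[R]_n) : continuous (fun u => dot u w).
Proof.
move=> u; apply/(@cvgrPdist_le _ _ _ _ (nbhs_filter u)) => e e0.
have e1 : 0 < e / (l2norm w + 1) by rewrite divr_gt0 // ltr_wpDl ?l2norm_ge0.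
apply: filterS (near_l2norm u e1) => y /= yu.
have -> : dot u w - dot y w = dot (u - y) w by rewrite !dotE.
apply: (le_trans (ler_dot_norm _ _)).
have w0 := l2norm_ge0 w; have := l2norm_ge0 (u - y).
move: yu; rewrite l2normB ltr_pdivlMr ?ltr_wpDl //.
by move: (l2norm _) (l2norm _) w0 => A B; nra.
Qed.

Lemma is_derive_dot x (t : R) v w : is_derive t 1 x v ->
  is_derive t 1 (fun s => dot (x s) w) (dot v w).
Proof.
move=> [/cvg_ex[/= l xl] <-].
have -> : 'D_1 x t = l by apply: cvg_lim.
have dl : (fun k : R => k^-1 *: (dot (x (k *: 1 + t)) w - dot (x t) w)) @ 0^' --> dot l w.
  rewrite (_ : (fun k : R => _) =
      (fun u => dot u w) \o (fun k : R => k^-1 *: (x (k *: 1 + t) - x t))).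
    by apply: cvg_comp xl _; exact: dot_cvg.
  by apply/funext => k; rewrite /= !dotE.
by split; [apply/cvg_ex; exists (dot l w) | apply: cvg_lim].
Qed.

(** The mean value inequality, from the mean value theorem for the component of
    [x] along the increment. *)
Lemma curve_lipschitz x (s t K : R) (v : R -> 'rV[R]_n) : s <= t -> 0 <= K ->
  {within `[s, t], continuous x} ->
  (forall u, s < u -> u < t -> is_derive u 1 x (v u) /\ l2norm (v u) <= K) ->
  l2norm (x t - x s) <= K * (t - s).
Proof.
move=> st K0 cx dx; set w := x t - x s.
have cphi : {within `[s, t], continuous (fun u => dot (x u) w)}.
  move=> u; apply: (@continuous_comp (subspace `[s, t]) _ _ x (fun u => dot u w)).
    exact: cx.
  exact: dot_cvg.
have dphi u : u \in `]s, t[%R -> is_derive u 1 (fun u => dot (x u) w) (dot (v u) w).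
  rewrite in_itv /= => /andP[su ut].
  by apply: is_derive_dot; have [] := dx u su ut.
move: st; rewrite le_eqVlt => /predU1P[ts|st].
  by rewrite /w ts !subrr l2norm0 mulr0.
have [u] := MVT st dphi cphi; rewrite in_itv /= => /andP[su ut].
have [_ vK] := dx u su ut.
have -> : dot (x t) w - dot (x s) w = l2norm w ^+ 2 by rewrite l2norm_sqr !dotE.
have := le_trans (dot_le (v u) w) (ler_wpM2r (l2norm_ge0 w) vK).
have := l2norm_ge0 w; have : 0 < t - s by rewrite subr_gt0.
move: (l2norm w) (dot (v u) w) (t - s) => N D r r0 N0 DKN Nr.
have [->|N1] := eqVneq N 0; first by rewrite mulr_ge0 // ltW.
have {N1}N1 : 0 < N by rewrite lt_neqAle eq_sym N1.
rewrite -(ler_pM2l N1) -expr2 Nr mulrA [N * K]mulrC.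
by rewrite ler_wpM2r // ltW.
Qed.

Lemma convex_l2ball (c : 'rV[R]_n) (r : R) : convex_set [set y | l2norm (y - c) <= r].
Proof.
apply/convex_setW => a b; rewrite !inE /= => ar br k k0 k1.
suff le_r : l2norm ((k%:num *: a + (1 - k%:num) *: b : 'rV[R]_n) - c) <= r.
  by rewrite inE; exact: le_r.
have -> : (k%:num *: a + (1 - k%:num) *: b : 'rV[R]_n) - c
    = k%:num *: (a - c) + (1 - k%:num) *: (b - c).
  by apply/rowP => i; rewrite !mxE; ring.
apply: le_trans (l2normD _ _) _; rewrite !l2normZ !ger0_norm ?subr_ge0 ?(ltW k0) ?(ltW k1) //.
move: k0 k1 ar br; move: (k%:num) (l2norm _) (l2norm _) => K A B k0 k1 ar br; nra.
Qed.

(** By continuity at [y] the values of [X] near [y] lie in a small closed ball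
    around [X y], which is convex and so contains the closed convex hull. *)
Lemma filippov_map_continuous X y v :
  {for y, continuous X} -> filippov_map X y v -> v = X y.
Proof.
move=> cX Fv; apply/eqP; rewrite -subr_eq0; apply/eqP/l2norm_eq0/eqP.
rewrite eq_le l2norm_ge0 andbT; apply/ler_addgt0Pr => e e0; rewrite add0r.
have [d d0 dX] := l2norm_nbhs (cX _ (near_l2norm (X y) e0)).
have null0 : lebesgue_null (set0 : set 'rV[R]_n).
  move=> r r0; exists set0, (fun=> 0), (fun=> 0); split => //.
  by rewrite esum_set0 lee_fin ltW.
have := Fv d d0 set0 null0.
move=> /(_ [set w | l2norm (w - X y) <= e]) /=; apply; split.
- exact: closed_l2ball.
- exact: convex_l2ball.
- by move=> _ [z [/= zy _] <-]; apply: ltW; exact: dX.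
Qed.

End Curves.

(** * Dissipation along trajectories *)

Lemma upper_slope_affine (R : realType) (g : R -> R) (t c K m : R) : 0 < K ->
  upper_slope g t c -> upper_slope (fun u => K * (g u - m)) t (K * c).
Proof.
move=> K0 gt e e0; apply: filterS (gt _ (divr_gt0 e0 K0)) => u.
rewrite -(ler_pM2l K0) -subr_ge0 => le; rewrite -subr_ge0; apply: ge0_eq le.
by field; rewrite gt_eqF.
Qed.

Section Dissipation.
Context {R : realType} {n : nat}.
Variables (f : 'rV[R]_n -> R) (h : 'rV[R]_n -> \bar R) (Lf lambda : R).
Hypotheses (f_diff : forall x, differentiable f x) (Lf_gt0 : 0 < Lf)
  (f_Lip : forall x z, l2norm (grad f x - grad f z) <= Lf * l2norm (x - z))
  (h_proper : proper_fun h) (h_lsc : lower_semicontinuous h)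
  (h_convex : econvex h)
  (lambda_gt0 : 0 < lambda) (lambda_lt : lambda < 1 / Lf).

Local Notation g := (grad f).
Local Notation H := (residual f h lambda).
Local Notation F := (fbe f h lambda).

Lemma one_sub_step_gt0 : 0 < 1 - lambda * Lf.
Proof. by rewrite subr_gt0; exact: step_lt1. Qed.

Lemma fbe_local : exists2 C : R, 0 <= C & forall x y,
  `|F y - F x| <= ((1 + lambda * Lf) * l2norm (H x) + C * l2norm (y - x)) * l2norm (y - x).
Proof.
have [C C0 exp] := fbe_expansion f_diff Lf_gt0 f_Lip h_proper h_lsc h_convex lambda_gt0.
exists C => // x y.
have e1 := ler_dot_norm (H x) (y - x).
have e2 : `|lambda * dot (g y - g x) (H x)|
    <= lambda * (Lf * l2norm (y - x) * l2norm (H x)).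
  rewrite normrM gtr0_norm // ler_wpM2l ?(ltW lambda_gt0) //.
  apply: le_trans (ler_dot_norm _ _) _.
  by rewrite ler_wpM2r ?l2norm_ge0.
have := exp x y; move: e1 e2.
move: (F x) (F y) (dot (H x) _) (lambda * dot _ _) (l2norm (H x)) (l2norm (y - x)).
move=> A B D E N M e1 e2 e3.
have -> : B - A = (B - A - (D - E)) + (D - E) by ring.
apply: le_trans (ler_normD _ _) _.
have := ler_normB D E.
have -> : ((1 + lambda * Lf) * N + C * M) * M
  = C * M ^+ 2 + (N * M + lambda * (Lf * M * N)) by ring.
by lra.
Qed.

(** The term [lambda * <grad f y - grad f x, H x>] of the expansion, which stands
    for the Hessian of [f], is bounded through the Lipschitz constant of the
    gradient. *)
Lemma fbe_slope (x : R -> 'rV[R]_n) (t : R) v : is_derive t 1 x v ->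
  upper_slope (F \o x) t (dot (H (x t)) v + lambda * Lf * l2norm v * l2norm (H (x t))).
Proof.
move=> xt e e0.
have [C C0 exp] := fbe_expansion f_diff Lf_gt0 f_Lip h_proper h_lsc h_convex lambda_gt0.
set r := l2norm (H (x t)); have r0 : 0 <= r := l2norm_ge0 _.
set q := l2norm v; have q0 : 0 <= q := l2norm_ge0 _.
have lL0 : 0 <= lambda * Lf by rewrite mulr_ge0 // ltW.
pose A := (1 + lambda * Lf) * r.
have A0 : 0 <= A by rewrite mulr_ge0 // addr_ge0.
pose eta := e / (2 * (A + 1)).
have eta0 : 0 < eta by rewrite divr_gt0 // mulr_gt0 //; lra.
have etaA : A * eta <= e / 2.
  rewrite /eta mulrA ler_pdivrMr; last by rewrite mulr_gt0 //; lra.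
  by have := ltW e0; nra.
pose B := C * (q + eta) ^+ 2.
have B0 : 0 <= B by rewrite mulr_ge0 ?sqr_ge0.
pose del := e / (2 * (B + 1)).
have del0 : 0 < del by rewrite divr_gt0 // mulr_gt0 //; lra.
have delB : B * del <= e / 2.
  rewrite /del mulrA ler_pdivrMr; last by rewrite mulr_gt0 //; lra.
  by have := ltW e0; nra.
have near_del : \forall u \near t, `|u - t| <= del.
  apply/nbhs_ballP; exists del => //= u; rewrite -ball_normE /= distrC.
  exact: ltW.
apply: filterS2 (is_derive_l2norm xt eta0) near_del => u; rewrite /comp.
set s := u - t; set w := x u - x t - s *: v => ws sdel.
have s0 := normr_ge0 s.
have dE : x u - x t = s *: v + w by rewrite /w [RHS]addrC subrK.
have dn : l2norm (x u - x t) <= (q + eta) * `|s|.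
  rewrite dE; apply: le_trans (l2normD _ _) _.
  by rewrite l2normZ mulrC mulrDl lerD2l.
have e1 : `|dot (H (x t)) w| <= r * (eta * `|s|).
  by apply: le_trans (ler_dot_norm _ _) _; rewrite ler_wpM2l.
have e2 : `|lambda * dot (g (x u) - g (x t)) (H (x t))| <= lambda * Lf * r * ((q + eta) * `|s|).
  rewrite normrM gtr0_norm // -!mulrA ler_wpM2l ?(ltW lambda_gt0) //.
  apply: le_trans (ler_dot_norm _ _) _; rewrite -/r.
  rewrite mulrCA [leLHS]mulrC ler_wpM2l //.
  by apply: le_trans (f_Lip _ _) _; rewrite ler_wpM2l // ltW.
have e3 : C * l2norm (x u - x t) ^+ 2 <= B * `|s| ^+ 2.
  rewrite /B -mulrA ler_wpM2l // -exprMn ler_sqr ?nnegrE ?l2norm_ge0 //.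
  by rewrite mulr_ge0 // addr_ge0 // ltW.
have := le_trans (exp (x t) (x u)) e3.
rewrite {1}dE dotDr dotZr; move: e1 e2.
move: (dot (H (x t)) v) (dot (H (x t)) w) (lambda * dot _ _) => D1 D2 D3.
move: (F (x u)) (F (x t)) => Fu Ft e1 e2 e4.
have ss : s * s = `|s| * `|s| by rewrite -normrM ger0_norm // -expr2 sqr_ge0.
(* s has either sign: only the leading term may keep it *)
have key : (Fu - Ft) * s <= s * (s * D1) + `|s| * (`|D2| + `|D3| + B * `|s| ^+ 2).
  have -> : (Fu - Ft) * s = s * (s * D1) + s * (D2 - D3 + (Fu - Ft - (s * D1 + D2 - D3))).
    by ring.
  rewrite lerD2l; apply: le_trans (ler_norm _) _; rewrite normrM ler_wpM2l //.
  by apply: le_trans (ler_normD _ _) _; apply: lerD => //; exact: ler_normB.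
apply: (le_trans key).
have -> : (D1 + lambda * Lf * q * r + e) * s ^+ 2
    = s * (s * D1) + `|s| * ((lambda * Lf * q * r + e) * `|s|).
  by rewrite expr2 [X in _ = _ + X]mulrCA -ss; ring.
rewrite lerD2l ler_wpM2l //.
have b1 : `|D2| + `|D3| <= lambda * Lf * q * r * `|s| + A * eta * `|s|.
  by apply: le_trans (lerD e1 e2) _; rewrite /A le_eqVlt; apply/orP; left; apply/eqP; ring.
have b2 : A * eta * `|s| <= e / 2 * `|s| by rewrite ler_wpM2r.
have b3 : B * `|s| ^+ 2 <= e / 2 * `|s|.
  rewrite expr2 mulrA ler_wpM2r //; apply: le_trans delB.
  by rewrite ler_wpM2l.
rewrite mulrDl; lra.
Qed.

Lemma residual_curve_bounded (x : R -> 'rV[R]_n) (M b : R) :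
  (forall t, 0 <= t -> t <= b -> l2norm (x t - x 0) <= M) ->
  exists2 N, 0 <= N & forall t, 0 <= t -> t <= b -> l2norm (H (x t)) <= N.
Proof.
move=> xM; have K0 : 0 <= 2 / lambda + Lf by rewrite addr_ge0 ?divr_ge0 // ltW.
exists (l2norm (H (x 0)) + (2 / lambda + Lf) * `|M|).
  by rewrite addr_ge0 ?l2norm_ge0 ?mulr_ge0.
move=> t t0 tb.
have := residual_lipschitz f_Lip h_proper h_lsc h_convex lambda_gt0 (x 0) (x t).
have := l2norm_dist (H (x t)) (H (x 0)) => i1 /(le_trans i1).
rewrite lerBlDl; move/le_trans; apply; rewrite lerD2l ler_wpM2l //.
by apply: le_trans (xM t t0 tb) (ler_norm _).
Qed.

(** [F] is Lipschitz on the bounded set covered by the curve. *)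
Lemma fbe_curve_ac (x : R -> 'rV[R]_n) b : 0 <= b -> curve_ac x b ->
  abs_cont (fun s t => `|F (x t) - F (x s)|) 0 b.
Proof.
move=> b0 acx; have [M xM] := curve_ac_bounded acx.
have [N N0 HN] := residual_curve_bounded xM.
have [C C0 loc] := fbe_local.
have M0 : 0 <= M by apply: le_trans (xM 0 (lexx 0) b0); exact: l2norm_ge0.
have lL0 : 0 <= lambda * Lf by rewrite mulr_ge0 // ltW.
apply: (@abs_cont_dominated _ ((1 + lambda * Lf) * N + C * (2 * M)) _ _ _ _ _ _ acx).
  by rewrite addr_ge0 ?mulr_ge0 ?addr_ge0.
move=> s t s0 st tb; apply: (le_trans (loc (x s) (x t))).
rewrite ler_wpM2r ?l2norm_ge0 //; apply: lerD; rewrite ler_wpM2l ?addr_ge0 //.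
  by apply: HN => //; lra.
have := l2norm_sub (x t - x 0) (x s - x 0); rewrite opprB addrA subrK.
have := xM t (le_trans s0 st) tb; have := xM s s0 (le_trans st tb); lra.
Qed.

Section Field.
Variables (p q kp kq : R).
Hypotheses (p_ge0 : 0 <= p) (p_lt1 : p < 1) (q_gt1 : 1 < q)
  (kp_gt0 : 0 < kp) (kq_gt0 : 0 < kq).
Local Notation X := (fxt_field f h lambda p q kp kq).

(** The velocity is [- gain |H| * H] where [H] does not vanish. *)
Definition gain (N : R) : R := kp / N `^ (1 - p) + kq * N `^ (q - 1).

Lemma fxt_fieldE y : H y != 0 -> X y = - (gain (l2norm (H y)) *: H y).
Proof.
by move=> H0; rewrite /fxt_field (negbTE H0) /gain scalerDl opprD.
Qed.

Lemma gain_ge0 N : 0 <= gain N.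
Proof.
by rewrite /gain addr_ge0 // ?divr_ge0 ?mulr_ge0 ?powR_ge0 // ltW.
Qed.

Lemma gain_mul N : 0 < N -> gain N * N = kp * N `^ p + kq * N `^ q.
Proof.
move=> N0; have Nn : N != 0 by rewrite gt_eqF.
rewrite /gain mulrDl -!mulrA; congr (_ * _ + _ * _).
  rewrite -powRN -{2}(powRr1 (ltW N0)) -powRD ?Nn ?implybT //.
  by congr (_ `^ _); ring.
rewrite -{2}(powRr1 (ltW N0)) -powRD ?Nn ?implybT //.
by congr (_ `^ _); ring.
Qed.

(** The dissipation [gain |H| * |H|^2] as a function of [|H|^2], the quantity
    that the proximal PL inequality controls. *)
Lemma gain_mul_sqr N : 0 < N -> gain N * N ^+ 2 =
  kp * (N ^+ 2) `^ ((1 + p) / 2) + kq * (N ^+ 2) `^ ((1 + q) / 2).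
Proof.
move=> N0; have Nn : N != 0 by rewrite gt_eqF.
rewrite expr2 mulrA gain_mul // -expr2 mulrDl -!mulrA.
have e r : N `^ r * N = (N ^+ 2) `^ ((1 + r) / 2).
  rewrite -powR_mulrn ?ltW // -powRrM -{2}(powRr1 (ltW N0)) -powRD ?Nn ?implybT //.
  by congr (_ `^ _); field.
by rewrite !e.
Qed.

Lemma fxt_field_bounded y N : 0 < p -> l2norm (H y) <= N ->
  l2norm (X y) <= kp * N `^ p + kq * N `^ q.
Proof.
move=> p0 HN; have N0 : 0 <= N := le_trans (l2norm_ge0 _) HN.
have [H0|H0] := eqVneq (H y) 0.
  rewrite /fxt_field H0 eqxx l2norm0.
  by rewrite addr_ge0 // mulr_ge0 ?powR_ge0 // ltW.
rewrite fxt_fieldE // l2normN l2normZ ger0_norm ?gain_ge0 //.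
rewrite gain_mul ?l2norm_gt0 //.
have mono r : 0 <= r -> l2norm (H y) `^ r <= N `^ r.
  by move=> r0; apply: ge0_ler_powR; rewrite ?nnegrE ?l2norm_ge0.
apply: lerD; apply: ler_wpM2l; rewrite ?(ltW kp_gt0) ?(ltW kq_gt0) //.
  exact: mono.
by apply: mono; exact: le_trans ler01 (ltW q_gt1).
Qed.

Lemma continuous_residual : continuous H.
Proof.
have K0 : 0 < 2 / lambda + Lf + 1.
  by rewrite ltr_wpDl // addr_ge0 ?divr_ge0 // ltW.
move=> y; apply/(@cvgrPdist_le _ _ _ _ (nbhs_filter y)) => e e0.
apply: filterS (near_l2norm y (divr_gt0 e0 K0)) => z /= zy.
rewrite distrC; apply: le_trans (mx_le_l2norm _) _.
apply: le_trans (residual_lipschitz f_Lip h_proper h_lsc h_convex lambda_gt0 y z) _.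
move: zy; rewrite ltr_pdivlMr //; have := l2norm_ge0 (z - y).
by move: (l2norm _) => A; lra.
Qed.

Lemma continuous_fxt_field y : H y != 0 -> {for y, continuous X}.
Proof.
move=> Hy; pose Y z := - (gain (l2norm (H z)) *: H z).
have cN : {for y, continuous (fun z => l2norm (H z))}.
  apply: continuous_comp; [exact: continuous_residual | exact: continuous_l2norm].
have N0 : 0 < l2norm (H y) by exact: l2norm_gt0.
have cpow (r : R) : {for l2norm (H y), continuous (fun N : R => N `^ r)}.
  apply: differentiable_continuous; apply/derivable1_diffP.
  by have [] := is_derive1_powR r N0.
have cY : {for y, continuous Y}.
  apply: continuousN; apply: continuousZ; last exact: continuous_residual.
  apply: (continuous_comp (f := fun z => l2norm (H z)) (g := gain)) => //.
  apply: cvgD; apply: cvgM; try exact: cvg_cst; last exact: cpow.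
  by apply: cvgV; [rewrite gt_eqF // powR_gt0 | exact: cpow].
have XY : {near y, X =1 Y}.
  move/cvgr_gt: cN => /(_ _ N0); apply: filterS => z Nz.
  have Hz : H z != 0 by apply: contraTneq Nz => ->; rewrite l2norm0 ltxx.
  exact: fxt_fieldE Hz.
have Xy : X y = Y y by exact: nbhs_singleton XY.
suff : X z @[z --> y] --> Y y by rewrite -Xy.
have YX : {near y, Y =1 X} by apply: filterS XY => z /esym.
exact: cvg_trans (@near_eq_cvg _ _ _ (nbhs_filter y) _ _ YX) cY.
Qed.

(** The common consequence of the two notions of solution: at a zero of the
    residual nothing is known of the velocity beyond its existence. *)
Definition descent_curve (x : R -> 'rV[R]_n) : Prop :=
  (forall b, 0 <= b -> curve_ac x b) /\
  {ae @lebesgue_measure R, forall t : R, 0 < t ->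
    exists2 v, is_derive t 1 x v & (H (x t) != 0 -> v = X (x t))}.

Lemma filippov_descent_curve x0 x : filippov_solution X x0 x -> descent_curve x.
Proof.
move=> [_ ac_x [A [mA A0 bad]]]; split.
  by move=> b b0; apply: absolutely_continuous_curve; exact: ac_x.
exists A; split => // t /= nt; apply: bad => /= xt; apply: nt => t0.
have [dx Fx] := xt (ltW t0).
exists (derive1 x t); first by rewrite derive1E; exact: derivableP.
by move=> H0; apply: filippov_map_continuous Fx; exact: continuous_fxt_field.
Qed.

(** On [[0, b]] the curve is bounded by compactness, hence so is the velocity:
    for [p > 0] the field is bounded by powers of [|H|] with positive exponents.
    The mean value inequality makes the curve Lipschitz. *)
Lemma classical_descent_curve x0 x : 0 < p -> classical_solution X x0 x -> descent_curve x.
Proof.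
move=> p0 [_ cx dx]; split; last first.
  exists set0; split; [exact: measurable0 | exact: measure0 |].
  by move=> t /= []; move=> t0; exists (X (x t)) => //; exact: dx.
move=> b b0.
have cxb s t : 0 <= s -> {within `[s, t], continuous x}.
  move=> s0; apply: continuous_subspaceW cx => u /=; rewrite !in_itv /= => /andP[su _].
  by rewrite andbT; lra.
have [M xM] : exists M, forall t, 0 <= t -> t <= b -> l2norm (x t - x 0) <= M.
  have cn : {within `[0, b], continuous (fun t => l2norm (x t - x 0))}.
    move=> u; apply: (@continuous_comp (subspace `[0, b]) _ _ x (fun y => l2norm (y - x 0))).
      exact: cxb.
    apply: continuous_comp; last exact: continuous_l2norm.
    exact: cvgB cvg_id (cvg_cst _).
  have [m _ mmax] := EVT_max b0 cn.
  by exists (l2norm (x m - x 0)) => t t0 tb; apply: mmax; rewrite in_itv /= t0.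
have [N N0 HN] := residual_curve_bounded xM.
pose K := kp * N `^ p + kq * N `^ q.
have K0 : 0 <= K by rewrite addr_ge0 // mulr_ge0 ?powR_ge0 // ltW.
apply: (@abs_cont_dominated _ K (fun s t => t - s)) => //; last first.
  by move=> e e0; exists e.
move=> s t s0 st tb.
apply: (curve_lipschitz (v := X \o x) st K0 (cxb s t s0)) => u su ut /=.
have u0 : 0 < u by lra.
by split; [exact: dx | apply: fxt_field_bounded => //; apply: HN; lra].
Qed.

(** The proximal PL inequality bounds [W := 2 mu (F - min F)] by [|H|^2], and
    along the trajectory the slope of [F] is at most
    [- (1 - lambda Lf) * gain |H| * |H|^2], whose two terms are powers of
    [|H|^2]. *)
Lemma descent_curve_converges (x : R -> 'rV[R]_n) (mu Fs : R) :
  0 < mu -> (forall y, Fs <= F y) ->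
  (forall y, mu * (F y - Fs) <= 2^-1 * l2norm (H y) ^+ 2) ->
  descent_curve x ->
  forall t, 1 / (mu * (1 - lambda * Lf)) * (1 / (kp * (1 - p)) + 1 / (kq * (q - 1))) <= t ->
  F (x t) = Fs.
Proof.
move=> mu0 Fmin PL [acx [A [mA A0 bad]]] t Tt.
pose W u := 2 * mu * (F (x u) - Fs).
have mu20 : 0 < 2 * mu by rewrite mulr_gt0.
have W_ge0 u : 0 <= W u by rewrite mulr_ge0 ?subr_ge0 // ltW.
have c0 : 0 < mu * (1 - lambda * Lf) by rewrite mulr_gt0 // one_sub_step_gt0.
have c20 : 0 < 2 * (mu * (1 - lambda * Lf)) by rewrite mulr_gt0.
have W_ac b : 0 <= b -> abs_cont (fun s t => `|W t - W s|) 0 b.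
  move=> b0; apply: (abs_cont_dominated (ltW mu20)) (fbe_curve_ac b0 (acx b b0)).
  move=> s u _ _ _; rewrite /W -mulrBr opprB addrA subrK normrM gtr0_norm //.
have slope (u : R) v : is_derive u 1 x v -> (H (x u) != 0 -> v = X (x u)) ->
    upper_slope W u (- (2 * (mu * (1 - lambda * Lf))
                        * (gain (l2norm (H (x u))) * l2norm (H (x u)) ^+ 2))).
  move=> xu vX; have := upper_slope_affine Fs mu20 (fbe_slope xu).
  apply: upper_slope_le; have [H0|H0] := eqVneq (H (x u)) 0.
    by rewrite H0 dot0l l2norm0 expr0n !mulr0 addr0 mulr0 oppr0.
  rewrite vX // fxt_fieldE // l2normN l2normZ ger0_norm ?gain_ge0 //.
  rewrite dotNr dotZr -l2norm_sqr le_eqVlt; apply/orP; left; apply/eqP; ring.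
have decay r k : 0 <= r -> 0 <= k ->
    (forall N, 0 < N -> k * (N ^+ 2) `^ ((1 + r) / 2) <= gain N * N ^+ 2) ->
    power_decay W (mu * (1 - lambda * Lf)) k r.
  move=> r0 k0 kgain; exists A; split => // u /= nu; apply: bad => /= xu.
  apply: nu => u0 Wu; have [v xv vX] := xu u0.
  apply: upper_slope_le (slope u v xv vX); rewrite lerN2 -mulrA ler_pM2l //.
  have WN : W u <= l2norm (H (x u)) ^+ 2 by have := PL (x u); rewrite /W; lra.
  have N0 : 0 < l2norm (H (x u)).
    rewrite lt_neqAle l2norm_ge0 andbT eq_sym; apply/eqP => N0.
    by move: WN; rewrite N0 expr0n /=; lra.
  apply: le_trans (kgain _ N0); rewrite ler_wpM2l //.
  by apply: ge0_ler_powR; rewrite ?nnegrE ?sqr_ge0 ?W_ge0 //; lra.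
have Wt0 : W t = 0.
  apply: (@fixed_time_extinction _ W (mu * (1 - lambda * Lf)) W_ge0 c0 W_ac _ p q kp kq) => //.
  - exists A; split => // u /= nu; apply: bad => /= xu; apply: nu => u0.
    have [v xv vX] := xu u0; apply: upper_slope_le (slope u v xv vX).
    rewrite oppr_le0; apply: mulr_ge0; first exact: ltW.
    by apply: mulr_ge0; [exact: gain_ge0 | exact: sqr_ge0].
  - apply: decay => //; first exact: ltW.
    move=> N N0; rewrite gain_mul_sqr // lerDl.
    by rewrite mulr_ge0 ?powR_ge0 // ltW.
  - apply: decay; [exact: le_trans ler01 (ltW q_gt1) | exact: ltW |].
    move=> N N0; rewrite gain_mul_sqr // lerDr.
    by rewrite mulr_ge0 ?powR_ge0 // ltW.
apply/eqP; rewrite -subr_eq0; move/eqP: Wt0; rewrite mulf_eq0.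
by rewrite gt_eqF.
Qed.

End Field.
End Dissipation.

Theorem theorem5 (R : realType) (n : nat)
    (f : 'rV[R]_n -> R) (h : 'rV[R]_n -> \bar R) (Lf : R)
    (f_C2 : twice_continuously_differentiable f)
    (Lf_gt0 : 0 < Lf)
    (f_Lip : forall x z : 'rV[R]_n,
       l2norm (grad f x - grad f z) <= Lf * l2norm (x - z))
    (h_proper : proper_fun h) (h_lsc : lower_semicontinuous h)
    (h_convex : econvex h)
    (lambda : R) (lambda_gt0 : 0 < lambda) (lambda_lt : lambda < 1 / Lf)
    (Fstar : \bar R) (Fstar_min : is_min (fb_envelope f h lambda) Fstar)
    (mu : R) (mu_gt0 : 0 < mu) (PL : proximal_PL f h lambda mu Fstar)
    (p q kp kq : R) (p_ge0 : 0 <= p) (p_lt1 : p < 1) (q_gt1 : 1 < q)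
    (kp_gt0 : 0 < kp) (kq_gt0 : 0 < kq) :
  forall x0 : 'rV[R]_n, exists T : R,
    [/\ 0 <= T,
        T <= 1 / (mu * (1 - lambda * Lf))
             * (1 / (kp * (1 - p)) + 1 / (kq * (q - 1))) &
        forall x : R -> 'rV[R]_n,
          trajectory f h lambda p q kp kq x0 x ->
          converges_in_time x (minimizers f h) T].
Proof.
move=> x0.
have [f_diff _ _] := f_C2.
have FE := fb_envelopeE f h_proper h_lsc h_convex lambda_gt0.
have step_gap := one_sub_step_gt0 Lf_gt0 lambda_lt.
exists (1 / (mu * (1 - lambda * Lf)) * (1 / (kp * (1 - p)) + 1 / (kq * (q - 1)))).
split.
- have p1 : 0 < 1 - p by rewrite subr_gt0.
  have q1 : 0 < q - 1 by rewrite subr_gt0.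
  by rewrite ltW // mulr_gt0 ?addr_gt0 // divr_gt0 // mulr_gt0.
- exact: lexx.
- move=> x traj t Tt.
  have [xm xm_min FstarE] := Fstar_min.
  have Fmin y : fbe f h lambda xm <= fbe f h lambda y.
    by have := xm_min y; rewrite !FE lee_fin.
  have PL' y : mu * (fbe f h lambda y - fbe f h lambda xm)
      <= 2^-1 * l2norm (residual f h lambda y) ^+ 2.
    by have := PL y; rewrite -FstarE !FE -EFinB -EFinM lee_fin.
  have desc : descent_curve f h lambda p q kp kq x.
    move: traj; rewrite /trajectory; case: eqVneq => [p0|p0].
      exact: (filippov_descent_curve Lf_gt0 f_Lip h_proper h_lsc h_convex
        lambda_gt0).
    apply: (classical_descent_curve Lf_gt0 f_Lip h_proper h_lsc h_convex
      lambda_gt0 p_ge0 q_gt1 kp_gt0 kq_gt0).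
    by rewrite lt_neqAle eq_sym p0.
  apply: (argmin_fbe_minimizers f_diff Lf_gt0 f_Lip h_proper h_lsc h_convex
    lambda_gt0 lambda_lt) => y.
  by rewrite (descent_curve_converges f_diff Lf_gt0 f_Lip h_proper h_lsc h_convex
    lambda_gt0 lambda_lt p_ge0 p_lt1 q_gt1 kp_gt0 kq_gt0 mu_gt0 Fmin PL' desc Tt).
Qed.
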